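(* Let $E=(E^0,E^1,r,s)$ be a directed graph, and let $\{F_1,F_2\}$ be an admissible decomposition of $E$. Then the commutative square of canonical surjections $$C^*(E)\to C^*(F_1),\quad C^*(E)\to C^*(F_2),\quad C^*(F_1)\to C^*(F_1\cap F_2),\quad C^*(F_2)\to C^*(F_1\cap F_2)$$ is a pullback diagram in the category of $\mathbb T$-$C^*$-algebras and $\mathbb T$-equivariant $*$-homomorphisms, where each graph $C^*$-algebra is equipped with its canonical gauge action.
   Context: A directed graph $E=(E^0,E^1,r,s)$ has vertex set $E^0$, edge set $E^1$ and range and source maps $r,s:E^1\to E^0$. For a graph $E$, $\operatorname{sink}(E)=\{v: s^{-1}(v)=\emptyset\}$, $\operatorname{reg}(E)=\{v\in E^0:0<|s^{-1}(v)|<\infty\}$ and $\operatorname{sing}(E)=E^0\setminus\operatorname{reg}(E)$. A subgraph $F$ of $E$ consists of subsets $F^0\subseteq E^0$, $F^1\subseteq E^1$ with range and source maps $r_F,s_F$ the restrictions of $r,s$; unions and intersections of subgraphs are taken on vertices and edges, and $\operatorname{sink},\operatorname{reg},\operatorname{sing}$ of a subgraph are computed within that subgraph. A pair $\{F_1,F_2\}$ of subgraphs of $E$ is an admissible decomposition of $E$ if: (a) $E=F_1\cup F_2$; (b) $\operatorname{sink}(F_1\cap F_2)\subseteq\operatorname{sing}(F_1)\cap\operatorname{sing}(F_2)$; (c) $F_1^1\cap F_2^1=r_{F_1}^{-1}(F_1^0\cap F_2^0)=r_{F_2}^{-1}(F_1^0\cap F_2^0)$; (d) $\operatorname{sing}(F_1)\cap\operatorname{reg}(F_1\cap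 F_2)\subseteq\operatorname{reg}(F_2)$. The graph $C^*$-algebra $C^*(E)$ is the universal $C^*$-algebra generated by mutually orthogonal projections $p_v$ ($v\in E^0$) and partial isometries $s_e$ ($e\in E^1$) with mutually orthogonal ranges such that $s_e^*s_e=p_{r(e)}$, $s_es_e^*\le p_{s(e)}$, and $p_v=\sum_{s(e)=v}s_es_e^*$ for all $v\in\operatorname{reg}(E)$. Its canonical gauge action of $\mathbb T$ is $\gamma_z(p_v)=p_v$, $\gamma_z(s_e)=z s_e$. The canonical surjection from the algebra of a graph to that of a subgraph sends the generators indexed by vertices and edges of the subgraph to the corresponding generators, and all other generators to $0$. A $\mathbb T$-$C^*$-algebra is a $C^*$-algebra with a strongly continuous action of $\mathbb T$. A commutative square of $\mathbb T$-equivariant $*$-homomorphisms $\rho_1:P\to A$, $\rho_2:P\to B$, $\mu_1:A\to C$, $\mu_2:B\to C$ is a pullback diagram if $p\mapsto(\rho_1(p),\rho_2(p))$ is a $\mathbb T$-equivariant $*$-isomorphism of $P$ onto $A\oplus_CB=\{(a,b)\in A\oplus B:\mu_1(a)=\mu_2(b)\}$ with the componentwise action. *)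

(* Defs.v *)
From HB Require Import structures.
From mathcomp Require Import all_boot all_order all_algebra.
From mathcomp Require Import all_classical all_reals all_analysis.
From mathcomp Require Import complex.

Set Implicit Arguments.
Unset Strict Implicit.
Unset Printing Implicit Defensive.

Import Order.TTheory GRing.Theory Num.Theory.
Import numFieldNormedType.Exports.

Local Open Scope classical_set_scope.
Local Open Scope ring_scope.

(** * C*-algebras *)

(* Complex C*-algebras, not assumed unital; this is why the product is not that
   of a MathComp ring.  The norm of an R[i]-normed module takes its values in
   the nonnegative reals of R[i]. *)
HB.mixin Record isCstarAlgebra (R : realType) A
    of CompleteNormedModule R[i] A := {
  cmul : A -> A -> A;
  star : A -> A;
  cmulA : forall x y z, cmul x (cmul y z) = cmul (cmul x y) z;
  cmulDl : forall x y z, cmul (x + y) z = cmul x z + cmul y z;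
  cmulDr : forall x y z, cmul x (y + z) = cmul x y + cmul x z;
  cmulZl : forall (a : R[i]) x y, cmul (a *: x) y = a *: cmul x y;
  cmulZr : forall (a : R[i]) x y, cmul x (a *: y) = a *: cmul x y;
  starK : forall x, star (star x) = x;
  starD : forall x y, star (x + y) = star x + star y;
  starZ : forall (a : R[i]) x, star (a *: x) = a^* *: star x;
  starM : forall x y, star (cmul x y) = cmul (star y) (star x);
  cnormM : forall x y, `|cmul x y| <= `|x| * `|y|;
  cnorm_star : forall x, `|cmul (star x) x| = `|x| ^+ 2
}.

#[short(type="cstarAlgType")]
HB.structure Definition CstarAlgebra (R : realType) :=
  {A of isCstarAlgebra R A & CompleteNormedModule R[i] A}.

Notation "x ** y" := (cmul x y) (at level 40, left associativity) : ring_scope.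

(* Makes pointed uniform products such as A * B canonical. *)
HB.saturate prod.

(* The direct sum A (+) B: componentwise operations and the maximum norm. *)
Section DirectSum.
Variables (R : realType) (A B : cstarAlgType R).

Let prod_complete (F : set_system (A * B)) :
  ProperFilter F -> cauchy F -> [cvg F in (A * B)%type].
Proof.
move=> FF /cauchy_ballP Fc.
have cA : cvg ((fst : A * B -> A) @ F).
  apply: cauchy_cvg; apply/cauchy_ballP => e e0.
  have [[P Q] [FP FQ] PQ] := Fc e e0.
  exists (fst @` P, fst @` Q) => /=.
    by split; [apply: filterS FP | apply: filterS FQ] => z ?; exists z.
  by move=> [_ _] [/= [x Px <-] [y Qy <-]]; have [] := PQ (x, y) (conj Px Qy).
have cB : cvg ((snd : A * B -> B) @ F).
  apply: cauchy_cvg; apply/cauchy_ballP => e e0.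
  have [[P Q] [FP FQ] PQ] := Fc e e0.
  exists (snd @` P, snd @` Q) => /=.
    by split; [apply: filterS FP | apply: filterS FQ] => z ?; exists z.
  by move=> [_ _] [/= [x Px <-] [y Qy <-]]; have [] := PQ (x, y) (conj Px Qy).
apply/cvg_ex; exists (lim (fst @ F), lim (snd @ F)).
have pairE : (fun x : A * B => (x.1, x.2)) = id by apply/funext => -[].
by have := @cvg_pair _ _ _ F _ _ _ _ _ _ _ cA cB; rewrite pairE; apply.
Qed.

HB.instance Definition _ :=
  Uniform_isComplete.Build (A * B)%type prod_complete.

Implicit Types x y z : A * B.

Let mulp x y : A * B := (x.1 ** y.1, x.2 ** y.2).
Let starp x : A * B := (star x.1, star x.2).

Let mulpA x y z : mulp x (mulp y z) = mulp (mulp x y) z.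
Proof. by rewrite /mulp /= !cmulA. Qed.
Let mulpDl x y z : mulp (x + y) z = mulp x z + mulp y z.
Proof. by rewrite /mulp /= !cmulDl. Qed.
Let mulpDr x y z : mulp x (y + z) = mulp x y + mulp x z.
Proof. by rewrite /mulp /= !cmulDr. Qed.
Let mulpZl (a : R[i]) x y : mulp (a *: x) y = a *: mulp x y.
Proof. by rewrite /mulp /= !cmulZl. Qed.
Let mulpZr (a : R[i]) x y : mulp x (a *: y) = a *: mulp x y.
Proof. by rewrite /mulp /= !cmulZr. Qed.
Let starpK x : starp (starp x) = x.
Proof. by case: x => a b; rewrite /starp /= !starK. Qed.
Let starpD x y : starp (x + y) = starp x + starp y.
Proof. by rewrite /starp /= !starD. Qed.
Let starpZ (a : R[i]) x : starp (a *: x) = a^* *: starp x.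
Proof. by rewrite /starp /= !starZ. Qed.
Let starpM x y : starp (mulp x y) = mulp (starp y) (starp x).
Proof. by rewrite /starp /mulp /= !starM. Qed.

Let normpM x y : `|mulp x y| <= `|x| * `|y|.
Proof.
have cmpx : `|x.1| >=< `|x.2| by rewrite real_comparable ?normr_real.
have cmpy : `|y.1| >=< `|y.2| by rewrite real_comparable ?normr_real.
have cmpz : `|x.1 ** y.1| >=< `|x.2 ** y.2|.
  by rewrite real_comparable ?normr_real.
rewrite !prod_normE /= comparable_ge_max //; apply/andP; split.
  apply: le_trans (cnormM _ _) _; apply: ler_pM => //.
    by rewrite comparable_le_max // lexx.
  by rewrite comparable_le_max // lexx.
apply: le_trans (cnormM _ _) _; apply: ler_pM => //.
  by rewrite comparable_le_max // lexx orbT.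
by rewrite comparable_le_max // lexx orbT.
Qed.

Let normp_star x : `|mulp (starp x) x| = `|x| ^+ 2.
Proof.
rewrite !prod_normE /= !cnorm_star.
have cmpx : `|x.1| >=< `|x.2| by rewrite real_comparable ?normr_real.
case: (comparable_ltP cmpx) => h.
  by rewrite /Order.max ltr_pXn2r ?nnegrE // h.
by rewrite /Order.max ltr_pXn2r ?nnegrE // (le_gtF h).
Qed.

HB.instance Definition _ := isCstarAlgebra.Build R (A * B)%type
  mulpA mulpDl mulpDr mulpZl mulpZr starpK starpD starpZ starpM normpM
  normp_star.

End DirectSum.

Record star_hom (R : realType) (A B : cstarAlgType R) (f : A -> B) : Prop := {
  star_hom_linear : linear f;
  star_homM : forall x y, f (x ** y) = f x ** f y;
  star_hom_star : forall x, f (star x) = star (f x)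
}.

Record closed_star_subalgebra (R : realType) (A : cstarAlgType R) (S : set A) :
    Prop := {
  css0 : S 0;
  cssD : forall x y, S x -> S y -> S (x + y);
  cssZ : forall (a : R[i]) x, S x -> S (a *: x);
  cssM : forall x y, S x -> S y -> S (x ** y);
  css_star : forall x, S x -> S (star x);
  css_closed : closed S
}.

Definition projection (R : realType) (A : cstarAlgType R) (p : A) : Prop :=
  star p = p /\ p ** p = p.

(* The order on projections. *)
Definition proj_le (R : realType) (A : cstarAlgType R) (p q : A) : Prop :=
  q ** p = p.

Definition partial_isometry (R : realType) (A : cstarAlgType R) (s : A) : Prop :=
  s ** star s ** s = s.

(** * Circle actions and pullbacks *)

Definition unit_circle (R : realType) : set R[i]^o :=
  [set z : R[i]^o | `|z| = 1].

(* Only the values of g on the unit circle matter.  Each g z is then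
   automatically an automorphism, with inverse g z^-1. *)
Record circle_action (R : realType) (A : cstarAlgType R) (g : R[i] -> A -> A) :
    Prop := {
  action_hom : forall z, unit_circle z -> star_hom (g z);
  action1 : forall x, g 1 x = x;
  actionM : forall z w x, unit_circle z -> unit_circle w ->
    g (z * w) x = g z (g w x);
  action_continuous : forall x,
    {within @unit_circle R, continuous (fun z : R[i]^o => g z x)}
}.

Definition equivariant (R : realType) (A B : cstarAlgType R)
    (gA : R[i] -> A -> A) (gB : R[i] -> B -> B) (f : A -> B) : Prop :=
  forall z x, unit_circle z -> f (gA z x) = gB z (f x).

Definition sum_action (R : realType) (A B : cstarAlgType R)
    (gA : R[i] -> A -> A) (gB : R[i] -> B -> B) : R[i] -> A * B -> A * B :=
  fun z x => (gA z x.1, gB z x.2).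

Record T_morphism (R : realType) (X Y : cstarAlgType R) (gX : R[i] -> X -> X)
    (gY : R[i] -> Y -> Y) (f : X -> Y) : Prop := {
  T_morphism_hom : star_hom f;
  T_morphism_equivariant : equivariant gX gY f
}.

Section Pullback.
Variables (R : realType) (P A B C : cstarAlgType R).
Variables (gP : R[i] -> P -> P) (gA : R[i] -> A -> A).
Variables (gB : R[i] -> B -> B) (gC : R[i] -> C -> C).
Variables (rho1 : P -> A) (rho2 : P -> B) (mu1 : A -> C) (mu2 : B -> C).

Definition pair_map (p : P) : A * B := (rho1 p, rho2 p).

(* The last two fields say that pair_map is a bijection of P onto the fibre
   product of mu1 and mu2 inside the direct sum. *)
Record T_pullback : Prop := {
  pb_actions : [/\ circle_action gP, circle_action gA,
                   circle_action gB & circle_action gC];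
  pb_rho : T_morphism gP gA rho1 /\ T_morphism gP gB rho2;
  pb_mu : T_morphism gA gC mu1 /\ T_morphism gB gC mu2;
  pb_comm : forall p, mu1 (rho1 p) = mu2 (rho2 p);
  pb_morphism : T_morphism gP (sum_action gA gB) pair_map;
  pb_injective : injective pair_map;
  pb_range : range pair_map = [set x : A * B | mu1 x.1 = mu2 x.2]
}.

End Pullback.

(** * Directed graphs *)

(* Edges form a choiceType only so that finite sums over sets of edges are
   available; classically, every type carries such a structure. *)
Record digraph := Digraph {
  vertex : Type;
  edge : choiceType;
  src : edge -> vertex;
  rng : edge -> vertex
}.

Record subgraph (E : digraph) := Subgraph {
  verts : set (vertex E);
  edges : set (edge E);
  edges_src : forall e, edges e -> verts (src e);
  edges_rng : forall e, edges e -> verts (rng e)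
}.

(* E regarded as a subgraph of itself. *)
Definition whole (E : digraph) : subgraph E :=
  @Subgraph E setT setT (fun _ _ => I) (fun _ _ => I).

Section Subgraphs.
Variable E : digraph.
Implicit Types F G : subgraph E.

Definition subgraphU F G : subgraph E.
Proof.
exists (verts F `|` verts G) (edges F `|` edges G).
- by move=> e [/edges_src|/edges_src]; [left|right].
- by move=> e [/edges_rng|/edges_rng]; [left|right].
Defined.

Definition subgraphI F G : subgraph E.
Proof.
exists (verts F `&` verts G) (edges F `&` edges G).
- by move=> e [/edges_src ? /edges_src ?].
- by move=> e [/edges_rng ? /edges_rng ?].
Defined.

Definition out F (v : vertex E) : set (edge E) :=
  [set e | edges F e /\ src e = v].

Definition sink F : set (vertex E) := [set v | verts F v /\ out F v = set0].

Definition reg F : set (vertex E) :=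
  [set v | [/\ verts F v, out F v !=set0 & finite_set (out F v)]].

Definition sing F : set (vertex E) := verts F `\` reg F.

Record admissible_decomposition F1 F2 : Prop := {
  adm_cover : subgraphU F1 F2 = whole E;
  adm_sink : sink (subgraphI F1 F2) `<=` sing F1 `&` sing F2;
  adm_edges1 : edges F1 `&` edges F2 =
    [set e | edges F1 e /\ (verts F1 `&` verts F2) (rng e)];
  adm_edges2 : edges F1 `&` edges F2 =
    [set e | edges F2 e /\ (verts F1 `&` verts F2) (rng e)];
  adm_reg : sing F1 `&` reg (subgraphI F1 F2) `<=` reg F2
}.

End Subgraphs.

(** * Graph C*-algebras *)

(* The values of p and s outside F are irrelevant. *)
Record CK_family (R : realType) (E : digraph) (F : subgraph E)
    (A : cstarAlgType R) (p : vertex E -> A) (s : edge E -> A) : Prop := {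
  CK_proj : forall v, verts F v -> projection (p v);
  CK_proj_orth : forall v w, verts F v -> verts F w -> v <> w ->
    p v ** p w = 0;
  CK_isom : forall e, edges F e -> partial_isometry (s e);
  CK_range_orth : forall e f, edges F e -> edges F f -> e <> f ->
    (s e ** star (s e)) ** (s f ** star (s f)) = 0;
  CK_source : forall e, edges F e -> star (s e) ** s e = p (rng e);
  CK_range : forall e, edges F e -> proj_le (s e ** star (s e)) (p (src e));
  CK_sum : forall v, reg F v ->
    p v = \sum_(e \in out F v) (s e ** star (s e))
}.

(* A model of C*(F): a C*-algebra generated by a universal family.  It is
   determined up to a unique isomorphism respecting the generators. *)
Record graph_cstar (R : realType) (E : digraph) (F : subgraph E) := {
  gc_alg :> cstarAlgType R;
  gc_p : vertex E -> gc_alg;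
  gc_s : edge E -> gc_alg;
  gc_family : CK_family F gc_p gc_s;
  gc_generated : forall S : set gc_alg, closed_star_subalgebra S ->
    (forall v, verts F v -> S (gc_p v)) ->
    (forall e, edges F e -> S (gc_s e)) -> S = setT;
  gc_universal : forall (B : cstarAlgType R) (q : vertex E -> B)
      (t : edge E -> B), CK_family F q t ->
    exists f : gc_alg -> B, [/\ star_hom f,
      forall v, verts F v -> f (gc_p v) = q v &
      forall e, edges F e -> f (gc_s e) = t e]
}.

Section GraphAlgebras.
Variables (R : realType) (E : digraph).

Record gauge_action (F : subgraph E) (A : graph_cstar R F)
    (g : R[i] -> A -> A) : Prop := {
  gauge_circle : circle_action g;
  gauge_p : forall z v, unit_circle z -> verts F v ->
    g z (gc_p A v) = gc_p A v;
  gauge_s : forall z e, unit_circle z -> edges F e ->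
    g z (gc_s A e) = z *: gc_s A e
}.

(* Meant for G a subgraph of F. *)
Record canonical_surjection (F G : subgraph E) (A : graph_cstar R F)
    (B : graph_cstar R G) (f : A -> B) : Prop := {
  canon_hom : star_hom f;
  canon_surj : range f = setT;
  canon_p : forall v, verts G v -> f (gc_p A v) = gc_p B v;
  canon_p0 : forall v, verts F v -> ~ verts G v -> f (gc_p A v) = 0;
  canon_s : forall e, edges G e -> f (gc_s A e) = gc_s B e;
  canon_s0 : forall e, edges F e -> ~ edges G e -> f (gc_s A e) = 0
}.

End GraphAlgebras.

(* Main.v *)
Require Import Defs.
From HB Require Import structures.
From mathcomp Require Import all_boot all_order all_algebra.
From mathcomp Require Import all_classical all_reals all_analysis.
From mathcomp Require Import complex.
From mathcomp Require Import ring lra.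
Import Order.TTheory GRing.Theory Num.Theory.
Import numFieldNormedType.Exports.
Local Open Scope classical_set_scope.
Local Open Scope ring_scope.

(** A star-homomorphism is contractive because a self-adjoint h of norm less
    than 1 is the real part of a "unitary" h + i sqrt(1 - h^2), and the quotient
    of a C*-algebra by a closed star-ideal is a C*-algebra because the ideal has
    approximate units.  Hence every canonical map C*(F) -> C*(G) is onto, and its
    kernel lies in each closed star-ideal containing the vertices and edges
    outside G together with the gaps p_v - sum s_e s_e^* for v in reg(G), the sum
    being over the edges of G leaving v.

    For an admissible decomposition the generators a of ker rho1 and b of
    ker rho2 satisfy a C*(E) b = 0, because paths never leave the complement of
    F1, nor that of F2.  So the two kernels are orthogonal: they intersect
    trivially, which is injectivity into the pullback, and their sum is closed.
    The sum is then an ideal of the kind above for F1 /\ F2, so it contains the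
    kernel of C*(E) -> C*(F1 /\ F2), which is surjectivity onto the pullback. *)

Set Implicit Arguments.
Unset Strict Implicit.
Unset Printing Implicit Defensive.

Local Notation "x %:C" := (real_complex _ x) : ring_scope.

(** The algebras have no unit, so 1 - g and the unitary built from h exist only as multiplication
    operators; the estimates are therefore stated for their effect on an element [y].

    The upper bound on a kernel comes from the universal property of C*(G): modulo an ideal
    containing the listed elements, the generators of G inside C*(F) satisfy the relations of G, so
    C*(G) maps back into the quotient, and whatever dies in C*(G) was already in the ideal.

    The obstacle to a C*(E) b = 0 is that the middle factor runs over a completion. Instead of
    expanding it in words, the closed span of the elements s_mu b t is shown to be stable under left
    multiplication by p_v, s_e and s_e^*, hence by all of C*(E), and a is shown to annihilate it.
    Condition (c) puts the range of an edge outside F_i outside F_i, which carries both computations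
    along a path. Condition (b) secures the regularity needed for the canonical maps to exist, and
    (d) places the gaps of F1 /\ F2 in the sum of the kernels. *)

Section RealNorm.
Variables (R : realType).
Implicit Types (V : normedModType R[i]).

(** The norm is [R[i]]-valued; its real part carries the same information in a totally ordered
    field, where linear arithmetic applies. *)
Definition rnorm V (x : V) : R := complex.Re `|x|.

Lemma rnormE V (x : V) : `|x| = (rnorm x)%:C.
Proof. by rewrite /rnorm RRe_real// normr_real. Qed.

Lemma rnorm_ge0 V (x : V) : 0 <= rnorm x.
Proof. by rewrite -ler0c -rnormE. Qed.

Lemma rnorm0 V : rnorm (0 : V) = 0.
Proof. by rewrite /rnorm normr0. Qed.

Lemma rnorm_eq0 V (x : V) : rnorm x = 0 -> x = 0.
Proof. by move=> x0; apply/normr0_eq0; rewrite rnormE x0. Qed.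

Lemma rnormN V (x : V) : rnorm (- x) = rnorm x.
Proof. by rewrite /rnorm normrN. Qed.

Lemma rnormD V (x y : V) : rnorm (x + y) <= rnorm x + rnorm y.
Proof. by rewrite -lecR rmorphD /= -!rnormE ler_normD. Qed.

Lemma rnormB V (x y : V) : rnorm (x - y) <= rnorm x + rnorm y.
Proof. by rewrite -(rnormN y) rnormD. Qed.

Lemma rnormBC V (x y : V) : rnorm (x - y) = rnorm (y - x).
Proof. by rewrite -rnormN opprB. Qed.

Lemma rnorm_triangle V (y x z : V) : rnorm (x - z) <= rnorm (x - y) + rnorm (y - z).
Proof. by apply: le_trans (rnormD _ _); rewrite addrA subrK. Qed.

Lemma rnormZ V (a : R[i]) (x : V) : rnorm (a *: x) = complex.Re `|a| * rnorm x.
Proof.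
apply: complexI; rewrite rmorphM /= (RRe_real (normr_real a)).
by rewrite -[in RHS]rnormE -[LHS]rnormE normrZ.
Qed.

Lemma rnormZr V (a : R) (x : V) : rnorm (a%:C *: x) = `|a| * rnorm x.
Proof. by rewrite rnormZ normc_def /= expr0n /= addr0 sqrtr_sqr. Qed.

Lemma posc_real (e : R[i]) : 0 < e -> exists2 r : R, 0 < r & e = r%:C.
Proof. by case: e => a b; rewrite ltcE /= => /andP[/eqP -> a0]; exists a. Qed.

Lemma rnorm_ballE V (x y : V) (r : R) : ball x r%:C y <-> rnorm (x - y) < r.
Proof. by rewrite -ball_normE /= rnormE ltcR. Qed.

Lemma cvg_rnormP V (T : Type) (F : set_system T) {FF : Filter F} (f : T -> V) (l : V) :
  (forall e : R, 0 < e -> \forall t \near F, rnorm (l - f t) < e) <->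
  f @ F --> l.
Proof.
split=> h.
  apply/cvgrPdist_lt => e /posc_real[r r0 ->].
  by apply: filterS (h r r0) => t; rewrite rnormE ltcR.
move=> r r0; have r0' : 0 < r%:C :> R[i] by rewrite ltcR.
move/cvgrPdist_lt : h => /(_ _ r0').
by apply: filterS => t; rewrite rnormE ltcR.
Qed.

Lemma cvg_rnorm_seq V (x : nat -> V) (l : V) :
  x @ \oo --> l ->
  forall e : R, 0 < e -> exists N, forall n, (N <= n)%N -> rnorm (l - x n) < e.
Proof.
move=> /cvg_rnormP h e /h [N _ hN].
by exists N => n Nn; exact: hN.
Qed.

Lemma additive_bounded_continuous V (W : normedModType R[i]) (f : V -> W) (C : R) :
  (forall x y, f (x - y) = f x - f y) ->
  (forall x, rnorm (f x) <= C * rnorm x) -> continuous f.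
Proof.
move=> fB fC x; apply/cvg_rnormP => e e0.
have C0 : 0 < `|C| + 1 by rewrite ltr_wpDl.
have := (@cvg_rnormP V V (nbhs x) (nbhs_filter x) id x).2 (fun _ h => h).
move=> /(_ (e / (`|C| + 1)) (divr_gt0 e0 C0)); apply: filterS => y.
rewrite ltr_pdivlMr// => h; rewrite -fB; apply: le_lt_trans (fC _) _.
apply: le_lt_trans h; rewrite mulrC ler_wpM2l ?rnorm_ge0//.
by apply: le_trans (ler_norm _) _; rewrite lerDl.
Qed.

Lemma closed_rnormP V (S : set V) :
  closed S <-> forall x, (forall e : R, 0 < e -> exists2 y, S y & rnorm (x - y) < e) -> S x.
Proof.
split=> [cS x h|h x clx].
  apply: cS => B /nbhs_ballP[_ /posc_real[r r0 ->] hB].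
  by have [y Sy xy] := h r r0; exists y; split=> //; apply: hB; apply/rnorm_ballE.
apply: h => e e0; have [|y [Sy /rnorm_ballE xy]] := clx (ball x e%:C).
  by apply: nbhsx_ballx; rewrite ltcR.
by exists y.
Qed.

End RealNorm.

Section FastCauchy.
Variables (R : realType) (V : completeNormedModType R[i]).

Lemma geometric_cauchy_cvg (x : nat -> V) (C q : R) :
  0 <= q < 1 -> (forall n, rnorm (x n.+1 - x n) <= C * q ^+ n) ->
  cvgn x.
Proof.
move=> /andP[q0 q1] hx.
have C0 : 0 <= C by apply: le_trans (rnorm_ge0 _) (le_trans (hx 0) _); rewrite expr0 mulr1.
have q1' : 0 < 1 - q by rewrite subr_gt0.
pose D := C / (1 - q).
have D0 : 0 <= D by rewrite divr_ge0// ltW.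
have dist n k : rnorm (x (n + k)%N - x n) <= D * q ^+ n.
  (* The exact partial geometric sum is kept, since the weaker bound [D * q ^+ n] does not survive
     the induction on [k]. *)
  have : rnorm (x (n + k)%N - x n) <= D * (q ^+ n - q ^+ (n + k)).
    elim: k => [|k IH]; first by rewrite addn0 !subrr rnorm0 mulr0.
    rewrite addnS; apply: le_trans (rnorm_triangle (x (n + k)%N) _ _) _.
    apply: le_trans (lerD (hx _) IH) _.
    rewrite exprS (_ : C = D * (1 - q)); last by rewrite /D mulfVK// gt_eqF.
    by rewrite le_eqVlt; apply/orP; left; apply/eqP; ring.
  move/le_trans; apply; rewrite ler_wpM2l// lerBlDr lerDl exprn_ge0//.
apply/cauchy_cvgP; apply/cauchy_ballP => _ /posc_real[e e0 ->].
have [N hN] : exists N, D * q ^+ N < e / 2.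
  have : (fun n => D * q ^+ n) @ \oo --> 0.
    rewrite -[X in _ --> X](mulr0 D); apply: cvgMr.
    by apply: cvg_expr; rewrite ger0_norm.
  move=> /cvgrPdist_lt /(_ (e / 2)); rewrite divr_gt0// => /(_ isT)[N _ /(_ N (leqnn N))].
  rewrite /= sub0r normrN ger0_norm; first by exists N.
  by rewrite mulr_ge0// exprn_ge0.
have near_N n : (N <= n)%N -> rnorm (x n - x N) < e / 2.
  by move=> Nn; apply: le_lt_trans hN; rewrite -{1}(subnKC Nn); apply: dist.
near_simpl; exists ([set n | (N <= n)%N], [set n | (N <= n)%N]); first by split; exists N.
move=> [n m] [/= Nn Nm]; apply/rnorm_ballE.
apply: le_lt_trans (rnorm_triangle (x N) _ _) _.
by rewrite (splitr e) ltrD// ?near_N// rnormBC near_N.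
Qed.

End FastCauchy.

(** * Contractivity of star-homomorphisms *)

Section CstarBasics.
Variables (R : realType) (A : cstarAlgType R).
Implicit Types x y z : A.

Lemma scale_halfD x : (2^-1 : R)%:C *: (x + x) = x.
Proof.
rewrite scalerDr -scalerDl -rmorphD (_ : 2^-1 + 2^-1 = 1 :> R) ?scale1r//.
by field.
Qed.

Lemma cmul0x x : 0 ** x = 0.
Proof. by apply: (@addrI _ (0 ** x)); rewrite -cmulDl !addr0. Qed.

Lemma cmulx0 x : x ** 0 = 0.
Proof. by apply: (@addrI _ (x ** 0)); rewrite -cmulDr !addr0. Qed.

Lemma cmulNx x y : (- x) ** y = - (x ** y).
Proof. by apply: (@addrI _ (x ** y)); rewrite -cmulDl !subrr cmul0x. Qed.

Lemma cmulxN x y : x ** (- y) = - (x ** y).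
Proof. by apply: (@addrI _ (x ** y)); rewrite -cmulDr !subrr cmulx0. Qed.

Lemma cmulBl x y z : (x - y) ** z = x ** z - y ** z.
Proof. by rewrite cmulDl cmulNx. Qed.

Lemma cmulBr x y z : z ** (x - y) = z ** x - z ** y.
Proof. by rewrite cmulDr cmulxN. Qed.

Lemma star0 : star (0 : A) = 0.
Proof. by apply: (@addrI _ (star 0)); rewrite -starD !addr0. Qed.

Lemma starN x : star (- x) = - star x.
Proof. by apply: (@addrI _ (star x)); rewrite -starD !subrr star0. Qed.

Lemma starB x y : star (x - y) = star x - star y.
Proof. by rewrite starD starN. Qed.

Lemma starZr (a : R) x : star (a%:C *: x) = a%:C *: star x.
Proof. by rewrite starZ conj_Creal// complex_real. Qed.

Lemma star_inj : injective (@star R A).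
Proof. by move=> x y h; rewrite -(starK x) h starK. Qed.

Lemma rnormM x y : rnorm (x ** y) <= rnorm x * rnorm y.
Proof. by rewrite -lecR rmorphM /= -!rnormE cnormM. Qed.

Lemma rnorm_cstar x : rnorm (star x ** x) = rnorm x ^+ 2.
Proof. by apply: complexI; rewrite rmorphXn /= -!rnormE cnorm_star. Qed.

Lemma rnorm_star x : rnorm (star x) = rnorm x.
Proof.
have le z : rnorm z <= rnorm (star z).
  have [->|z0] := eqVneq (rnorm z) 0; first exact: rnorm_ge0.
  have zp : 0 < rnorm z by rewrite lt_neqAle eq_sym z0 rnorm_ge0.
  by rewrite -(ler_pM2r zp) -expr2 -rnorm_cstar rnormM.
by apply/eqP; rewrite eq_le le -{2}(starK x) le.
Qed.

Lemma rnorm_selfadjoint x : star x = x -> rnorm (x ** x) = rnorm x ^+ 2.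
Proof. by move=> xs; rewrite -{1}xs rnorm_cstar. Qed.

Lemma cstar_eq0 x : star x ** x = 0 -> x = 0.
Proof.
move=> h; apply: rnorm_eq0; apply/eqP.
by rewrite -sqrf_eq0 -rnorm_cstar h rnorm0.
Qed.

Lemma continuous_cmull x : continuous (fun y => x ** y).
Proof.
by apply: (@additive_bounded_continuous R A A _ (rnorm x)) => y *; rewrite ?cmulBr ?rnormM.
Qed.

Lemma continuous_cmulr x : continuous (fun y => y ** x).
Proof.
apply: (@additive_bounded_continuous R A A _ (rnorm x)) => y *; rewrite ?cmulBl//.
by rewrite mulrC rnormM.
Qed.

Lemma continuous_star : continuous (@star R A).
Proof.
by apply: (@additive_bounded_continuous R A A _ 1) => y *; rewrite ?starB ?mul1r ?rnorm_star.
Qed.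

Lemma cvg_cmul (T : Type) (F : set_system T) (FF : Filter F) (f g : T -> A) x y :
  f @ F --> x -> g @ F --> y -> (fun t => f t ** g t) @ F --> x ** y.
Proof.
move=> fx gy.
have -> : (fun t => f t ** g t) =
    (fun t => (f t - x) ** (g t - y) + x ** (g t - y) + f t ** y).
  by apply/funext => t; rewrite -cmulDl subrK -cmulDr subrK.
have gy0 : (fun t => g t - y) @ F --> (0 : A).
  by rewrite -[X in _ --> X](subrr y); apply: cvgB => //; exact: cvg_cst.
have -> : x ** y = 0 + x ** 0 + x ** y by rewrite cmulx0 !add0r.
apply: cvgD; last exact: (@continuous_cvg _ _ _ _ FF _ (fun w => w ** y) _ (@continuous_cmulr y x) fx).
apply: cvgD; last exact: (@continuous_cvg _ _ _ _ FF _ (fun w => x ** w) _ (@continuous_cmull x 0) gy0).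
apply/cvg_rnormP => e e0.
have h1 := (cvg_rnormP _ _).2 fx e e0.
have h2 := (cvg_rnormP _ _).2 gy 1 ltr01.
near=> t; rewrite sub0r rnormN; apply: le_lt_trans (rnormM _ _) _.
have a1 : rnorm (x - f t) < e by near: t; exact: h1.
have a2 : rnorm (y - g t) < 1 by near: t; exact: h2.
rewrite rnormBC in a1; apply: le_lt_trans a1.
by rewrite ler_piMr ?rnorm_ge0// rnormBC ltW.
Unshelve. all: by end_near. Qed.

(** The cross terms cancel, so p + iq and p - iq both satisfy w^* w = p^* p + q^* q, and [p] is
    their mean. This replaces monotonicity of the norm on positive elements. *)
Lemma rnorm_cartesian (p q : A) : star p ** q = star q ** p ->
  rnorm p ^+ 2 <= rnorm (star p ** p + star q ** q).
Proof.
move=> pq; set c := rnorm (_ + _).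
have key (a : R[i]) : a^* = - a -> a ^+ 2 = -1 -> rnorm (p + a *: q) <= Num.sqrt c.
  move=> ha1 ha2; rewrite -(ger0_norm (rnorm_ge0 _)) -sqrtr_sqr ler_wsqrtr//.
  rewrite -rnorm_cstar starD starZ ha1 cmulDl !cmulDr !cmulZl !cmulZr pq.
  rewrite scalerA mulNr -expr2 ha2 opprK scale1r scaleNr.
  by rewrite addrA addrK.
have kp := key 'i%R (conjCi _) (sqrCi _).
have km : rnorm (p + - 'i%R *: q) <= Num.sqrt c.
  by apply: key; rewrite ?rmorphN/= ?conjCi// sqrrN sqrCi.
have : rnorm ((2 : R)%:C *: p) <= Num.sqrt c + Num.sqrt c.
  have -> : (2 : R)%:C *: p = (p + 'i%R *: q) + (p + (- 'i%R) *: q).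
    rewrite scaleNr addrACA subrr addr0 (_ : 2%:C = 2%:R); last by rewrite rmorph_nat.
    by rewrite scaler_nat.
  by apply: le_trans (rnormD _ _) _; rewrite lerD.
rewrite rnormZr ger0_norm// => h2.
have h : rnorm p <= Num.sqrt c by lra.
have c0 : 0 <= c by apply: rnorm_ge0.
by rewrite -(sqr_sqrtr c0) lerXn2r// nnegrE ?rnorm_ge0 ?sqrtr_ge0.
Qed.

(* With u = h + i(1 - g), u and its adjoint are isometries. *)
Lemma rnorm_half_circle (h g y : A) : star h = h -> star g = g -> g ** h = h ** g ->
  g + g - g ** g = h ** h ->
  rnorm (h ** y) <= rnorm y /\ rnorm (y - g ** y) <= rnorm y.
Proof.
move=> hs gs gh gE.
pose z := y - g ** y.
have pq : star (h ** y) ** z = star z ** (h ** y).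
  rewrite /z starM hs starB starM gs cmulBr cmulBl !cmulA.
  by rewrite -(cmulA (star y) g h) gh !cmulA.
(* The hypothesis on [g] reads h^2 + (1 - g)^2 = 1, applied here to [y] on both sides. *)
have sum : star (h ** y) ** (h ** y) + star z ** z = star y ** y.
  rewrite starM hs /z starB starM gs cmulBl -!cmulA -cmulBr -cmulDr (cmulA h h) -gE.
  congr (_ ** _); rewrite cmulBr cmulBl cmulDl -cmulA; set u := g ** y; set v := g ** u.
  rewrite -[u + u - v]addrA; set w := u - v.
  by rewrite -addrA [w + _]addrC subrK addrC subrK.
have yy : rnorm y ^+ 2 = rnorm (star y ** y) by rewrite rnorm_cstar.
have le_sq (w : A) : rnorm w ^+ 2 <= rnorm y ^+ 2 -> rnorm w <= rnorm y.
  by rewrite ler_pXn2r// nnegrE rnorm_ge0.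
split; apply: le_sq; rewrite yy -sum.
  exact: rnorm_cartesian.
by rewrite [_ + star z ** z]addrC; exact: rnorm_cartesian (esym pq).
Qed.

End CstarBasics.

Section HalfCircle.
Variables (R : realType) (A : cstarAlgType R).

(* g = 1 - sqrt(1 - h^2), as the limit of an iteration. *)
Lemma half_circle_exists (h : A) : star h = h -> rnorm h < 1 ->
  exists g : A, [/\ star g = g, g ** h = h ** g & g + g - g ** g = h ** h].
Proof.
move=> hs h1.
(* The equation for [g] is the fixed-point equation g = (h^2 + g^2) / 2. Started at 0, the iteration
   stays in the ball of radius [r], the norm of h^2, where the map contracts by the factor [r]. *)
pose x := fix x n : A := if n is m.+1 then ((2^-1 : R)%:C) *: (h ** h + x m ** x m) else 0.
pose r := rnorm (h ** h).
have r01 : 0 <= r < 1.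
  rewrite rnorm_ge0 /r rnorm_selfadjoint//=.
  by rewrite expr_lt1// rnorm_ge0.
have [r0 r1] := andP r01.
have xr n : rnorm (x n) <= r.
  elim: n => [|n IH] /=; first by rewrite rnorm0.
  rewrite rnormZr ger0_norm ?invr_ge0// ler_pdivrMl//.
  apply: le_trans (rnormD _ _) _; rewrite -/r mulr_natl mulr2n lerD2l.
  apply: le_trans (rnormM _ _) _; apply: le_trans (ler_pM _ _ IH IH) _; rewrite ?rnorm_ge0//.
  by rewrite ler_piMl// ltW.
have xs n : star (x n) = x n.
  by elim: n => [|n IH] /=; rewrite ?star0// starZr starD !starM hs IH.
have xh n : x n ** h = h ** x n.
  elim: n => [|n IH] /=; first by rewrite cmul0x cmulx0.
  by rewrite cmulZl cmulZr cmulDl cmulDr !cmulA -(cmulA (x n)) IH !cmulA IH.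
have xC n : rnorm (x n.+1 - x n) <= r * r ^+ n.
  elim: n => [|n IH].
    by rewrite expr0 mulr1 [x 0]/= subr0.
  have xS m : x m.+1 = (2^-1)%:C *: (h ** h + x m ** x m) by [].
  rewrite (xS n.+1) {3}(xS n).
  set u := x n.+1; set v := x n in IH *.
  rewrite -scalerBr rnormZr ger0_norm ?invr_ge0// ler_pdivrMl//.
  have -> : h ** h + u ** u - (h ** h + v ** v) = u ** (u - v) + (u - v) ** v.
    by rewrite cmulBl cmulBr opprD addrACA subrr add0r addrA subrK.
  apply: le_trans (rnormD _ _) _; rewrite mulr_natl mulr2n exprS.
  have rn : 0 <= r ^+ n by rewrite exprn_ge0.
  rewrite lerD//; apply: le_trans (rnormM _ _) _; last rewrite mulrC;
    by apply: ler_pM; rewrite ?rnorm_ge0// xr.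
have /cvg_ex[g xg] := geometric_cauchy_cvg r01 xC.
exists g; split.
- apply: (@cvg_unique _ (@norm_hausdorff _ A) (x @ \oo) _ _ _ _ xg) => //.
  rewrite (_ : x = star \o x); last by apply/funext => n /=; rewrite xs.
  exact: continuous_cvg (@continuous_star R A g) xg.
- apply: (@cvg_unique _ (@norm_hausdorff _ A) ((fun n => x n ** h) @ \oo)).
    exact: continuous_cvg (@continuous_cmulr R A h g) xg.
  rewrite (_ : (fun n => _) = (fun n => h ** x n)); last by apply/funext => n; rewrite xh.
  exact: continuous_cvg (@continuous_cmull R A h g) xg.
- have gE : g = (2^-1 : R)%:C *: (h ** h + g ** g).
    have h3 : (fun n => x n.+1) @ \oo --> g by rewrite (cvg_shiftS x).
    apply: (@cvg_unique _ (@norm_hausdorff _ A) _ _ _ _ h3) => /=.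
    apply: cvgZr; apply: cvgD; first exact: cvg_cst.
    exact: cvg_cmul.
  have gg : g + g = h ** h + g ** g.
    by rewrite {1 2}gE -scalerDr scale_halfD.
  by rewrite gg addrK.
Qed.

(** As left multiplications, 1 - h^2 = (1 - g)^2 with [g] from [half_circle_exists], and 1 - g is a
    contraction. *)
Lemma rnorm_cmul_unitball (h y : A) : star h = h -> rnorm h < 1 ->
  rnorm (y - h ** (h ** y)) <= rnorm y.
Proof.
move=> hs /(half_circle_exists hs)[g [gs gh gE]].
have c z := (rnorm_half_circle z hs gs gh gE).2.
have -> : y - h ** (h ** y) = (y - g ** y) - g ** (y - g ** y).
  rewrite cmulA -gE cmulBl cmulDl -cmulA cmulBr.
  by rewrite -[g ** y + _ - _]addrA [in LHS]opprD addrA.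
exact: le_trans (c _) (c _).
Qed.

End HalfCircle.

Section StarHoms.
Variables (R : realType).
Implicit Types A B C : cstarAlgType R.

Section Basic.
Variables (A B : cstarAlgType R) (f : A -> B) (hf : star_hom f).

Lemma star_homD x y : f (x + y) = f x + f y.
Proof. by have := star_hom_linear hf 1 x y; rewrite !scale1r. Qed.

Lemma star_hom0 : f 0 = 0.
Proof. by apply: (@addrI _ (f 0)); rewrite -star_homD !addr0. Qed.

Lemma star_homZ (a : R[i]) x : f (a *: x) = a *: f x.
Proof. by have := star_hom_linear hf a x 0; rewrite star_hom0 !addr0. Qed.

Lemma star_homN x : f (- x) = - f x.
Proof. by apply: (@addrI _ (f x)); rewrite -star_homD !subrr star_hom0. Qed.

Lemma star_homB x y : f (x - y) = f x - f y.
Proof. by rewrite star_homD star_homN. Qed.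

Lemma star_hom_rnorm x : rnorm (f x) <= rnorm x.
Proof.
(* [f] preserves the equations linking [h] and [g], so left multiplication by [f h] is a
   contraction; applied to [f h] itself this says that the square of its norm is at most its
   norm. *)
have unit h : star h = h -> rnorm h < 1 -> rnorm (f h) <= 1.
  move=> hs /(half_circle_exists hs)[g [gs gh gE]].
  have [||||+ _] := @rnorm_half_circle R B (f h) (f g) (f h).
  - by rewrite -(star_hom_star hf) hs.
  - by rewrite -(star_hom_star hf) gs.
  - by rewrite -!(star_homM hf) gh.
  - by rewrite -!(star_homM hf) -star_homD -star_homB gE.
  rewrite rnorm_selfadjoint; last by rewrite -(star_hom_star hf) hs.
  have [->//|f0] := eqVneq (rnorm (f h)) 0.
  have fp : 0 < rnorm (f h) by rewrite lt_neqAle eq_sym f0 rnorm_ge0.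
  by rewrite expr2 ger_pMr.
have sa h : star h = h -> rnorm (f h) <= rnorm h.
  move=> hs; rewrite leNgt; apply/negP => hlt.
  (* Dividing by a number strictly between the two norms would give an element of norm below 1 with
     an image of norm above 1. *)
  pose c := (rnorm h + rnorm (f h)) / 2.
  have [c1 c2] : rnorm h < c /\ c < rnorm (f h) by rewrite /c; split; lra.
  have c0 : 0 < c by apply: le_lt_trans c1; exact: rnorm_ge0.
  have := unit (c^-1%:C *: h); rewrite starZr hs => /(_ erefl).
  rewrite star_homZ !rnormZr gtr0_norm ?invr_gt0// !ltr_pdivrMl// !ler_pdivrMl// !mulr1.
  by move=> /(_ c1); rewrite leNgt c2.
have : rnorm (f x) ^+ 2 <= rnorm x ^+ 2.
  rewrite -!rnorm_cstar -(star_hom_star hf) -(star_homM hf) sa//.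
  by rewrite starM starK.
by rewrite ler_pXn2r// nnegrE rnorm_ge0.
Qed.

Lemma star_hom_continuous : continuous f.
Proof.
apply: (@additive_bounded_continuous R A B _ 1) => x *; first exact: star_homB.
by rewrite mul1r star_hom_rnorm.
Qed.

End Basic.

Lemma star_hom_comp A B C (f : A -> B) (g : B -> C) :
  star_hom f -> star_hom g -> star_hom (fun x => g (f x)).
Proof.
move=> hf hg; split=> [a x y|x y|x].
- by rewrite /= (star_hom_linear hf) (star_hom_linear hg).
- by rewrite (star_homM hf) (star_homM hg).
- by rewrite (star_hom_star hf) (star_hom_star hg).
Qed.

Lemma star_hom_id A : star_hom (fun x : A => x).
Proof. by split. Qed.

Lemma closed_equalizer A B (f g : A -> B) :
  continuous f -> continuous g -> closed [set x | f x = g x].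
Proof.
move=> fc gc.
have -> : [set x | f x = g x] = (fun x => f x - g x) @^-1` [set 0].
  by apply/seteqP; split => x /= /eqP; rewrite ?subr_eq0 => /eqP //; move=> ->; rewrite subrr.
apply: closed_comp; last by apply: accessible_closed_set1; exact/hausdorff_accessible/norm_hausdorff.
by move=> x _; apply: cvgB; [exact: fc | exact: gc].
Qed.

Lemma css_equalizer A B (f g : A -> B) : star_hom f -> star_hom g ->
  closed_star_subalgebra [set x | f x = g x].
Proof.
move=> hf hg; split=> /=.
- by rewrite !star_hom0.
- by move=> x y xE yE; rewrite !star_homD// xE yE.
- by move=> a x xE; rewrite !star_homZ// xE.
- by move=> x y xE yE; rewrite (star_homM hf) (star_homM hg) xE yE.
- by move=> x xE; rewrite (star_hom_star hf) (star_hom_star hg) xE.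
- by apply: closed_equalizer; exact: star_hom_continuous.
Qed.

End StarHoms.

(** * Quotients by closed star-ideals *)

Record closed_star_ideal (R : realType) (A : cstarAlgType R) (S : set A) : Prop := {
  csi0 : S 0;
  csiD : forall x y, S x -> S y -> S (x + y);
  csiZ : forall (a : R[i]) x, S x -> S (a *: x);
  csiMl : forall x y, S y -> S (x ** y);
  csi_star : forall x, S x -> S (star x);
  csi_closed : closed S
}.

Section Ideals.
Variables (R : realType) (A : cstarAlgType R) (S : set A).
Hypothesis hS : closed_star_ideal S.

Lemma csiMr x y : S x -> S (x ** y).
Proof.
move=> Sx; rewrite -(starK (x ** y)) starM.
by apply: (csi_star hS); apply: (csiMl hS); apply: (csi_star hS).
Qed.

Lemma csiN x : S x -> S (- x).
Proof. by rewrite -scaleN1r; apply: (csiZ hS). Qed.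

Lemma csiB x y : S x -> S y -> S (x - y).
Proof. by move=> Sx Sy; apply: (csiD hS) => //; apply: csiN. Qed.

(* With a = (t j)^2 of norm less than 1, f n = 1 - (1 - a)^n and e is the mean
   of f 0, ..., f (n-1): the telescoping a - a e = f n / n makes a - a e small. *)
Lemma ideal_approx_unit (j : A) (eps : R) : S j -> star j = j -> 0 < eps ->
  exists e : A, [/\ S e, star e = e,
    forall y, rnorm (y - e ** y) <= rnorm y & rnorm (j - j ** e) ^+ 2 <= eps].
Proof.
move=> Sj js eps0.
pose t := (1 + rnorm j)^-1.
have p0 : 0 < 1 + rnorm j by rewrite ltr_wpDr// rnorm_ge0.
have t0 : 0 < t by rewrite invr_gt0.
pose h := t%:C *: j.
have hs : star h = h by rewrite /h starZr js.
have h1 : rnorm h < 1.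
  by rewrite rnormZr gtr0_norm// /t ltr_pdivrMl// mulr1 ltrDr.
have [a ahh] : exists a, a = h ** h by exists (h ** h).
have as_ : star a = a by rewrite ahh starM hs.
have Sa : S a by rewrite ahh /h cmulZl; apply: (csiZ hS); exact: csiMr.
pose f := fix f n : A := if n is m.+1 then f m + (a - a ** f m) else 0.
have Sf n : S (f n).
  elim: n => [|n IH] /=; first exact: csi0 hS.
  by apply: (csiD hS) => //; apply: csiB => //; exact: csiMr.
have fa n : f n ** a = a ** f n.
  elim: n => [|n IH] /=; first by rewrite cmul0x cmulx0.
  by rewrite cmulDl cmulDr cmulBl cmulBr IH -!cmulA IH.
have fs n : star (f n) = f n.
  elim: n => [|n IH] /=; first by rewrite star0.
  by rewrite starD starB starM IH as_ fa.
have fc n y : rnorm (y - f n ** y) <= rnorm y.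
  elim: n => [|n IH] /=; first by rewrite cmul0x subr0.
  have -> : y - (f n + (a - a ** f n)) ** y = (y - f n ** y) - h ** (h ** (y - f n ** y)).
    by rewrite (cmulA h h) -ahh cmulBr cmulDl cmulBl (cmulA a) opprD addrA.
  exact: le_trans (rnorm_cmul_unitball _ hs h1) IH.
(* Since 1 - f_n is a contraction, f_n - f_n^2 has norm at most that of f_n; hence the square of the
   norm of f_n is at most twice that norm. *)
have f2 n : rnorm (f n) <= 2.
  have := rnormB (f n) (f n - f n ** f n).
  rewrite subKr (rnorm_selfadjoint (fs n)) => h2.
  have {h2} : rnorm (f n) ^+ 2 <= 2 * rnorm (f n).
    by apply: le_trans h2 _; rewrite mulr_natl mulr2n lerD2l.
  have [->//|f0] := eqVneq (rnorm (f n)) 0.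
  have fp : 0 < rnorm (f n) by rewrite lt_neqAle eq_sym f0 rnorm_ge0.
  by rewrite expr2 ler_pM2r.
have fsum n : \sum_(k < n) (a - a ** f k) = f n.
  elim: n => [|n IH]; first by rewrite big_ord0.
  by rewrite big_ord_recr /= IH.
(* At the end the square of the norm of j - je is that of (1 - e) j^2 (1 - e). Here j^2 = t^-2 a,
   and a - ae = f_n / n has norm at most 2 / n. *)
have [n n0 nlarge] : exists2 n, (0 < n)%N & t ^- 2 * (2 / n%:R) <= eps.
  pose M := t ^- 2 * 2 / eps.
  have M0 : 0 <= M by rewrite divr_ge0 ?mulr_ge0 ?invr_ge0 ?exprn_ge0 // ltW.
  have [n hn] : exists n : nat, M < n%:R.
    by exists (Num.bound M); exact: archi_boundP.
  have nR : 0 < n%:R :> R by apply: le_lt_trans hn.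
  exists n; first by rewrite -(ltr_nat R).
  by rewrite mulrA ler_pdivrMr// [eps * _]mulrC -ler_pdivrMr// ltW.
have nR : 0 < n%:R :> R by rewrite ltr0n.
have nC : (n%:R^-1 : R)%:C * n%:R = 1 :> R[i].
  by rewrite -(rmorph_nat (real_complex R)) -rmorphM mulVf// gt_eqF.
pose e := (n%:R^-1 : R)%:C *: \sum_(k < n) f k.
have Se : S e.
  apply: (csiZ hS); apply: (big_ind S) => //; first exact: csi0 hS.
  by move=> x y; exact: (csiD hS).
have es : star e = e.
  rewrite starZr; congr (_ *: _).
  rewrite (big_morph (@star R A) (@starD R A) (@star0 R A)).
  by apply: eq_bigr => k _; rewrite fs.
have ae : a - a ** e = (n%:R^-1 : R)%:C *: f n.
  rewrite -fsum sumrB sumr_const card_ord scalerBr -[a *+ n]scaler_nat scalerA nC scale1r.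
  congr (_ - _); rewrite cmulZr; congr (_ *: _).
  by rewrite (big_morph (fun x => a ** x) (cmulDr a) (cmulx0 a)).
have ec y : rnorm (y - e ** y) <= rnorm y.
  have -> : y - e ** y = (n%:R^-1 : R)%:C *: \sum_(k < n) (y - f k ** y).
    rewrite sumrB sumr_const card_ord scalerBr -[y *+ n]scaler_nat scalerA nC scale1r.
    congr (_ - _); rewrite cmulZl; congr (_ *: _).
    by rewrite (big_morph (fun x => x ** y) (fun u v => cmulDl u v y) (cmul0x y)).
  rewrite rnormZr gtr0_norm ?invr_gt0// ler_pdivrMl// mulr_natl.
  have : rnorm (\sum_(k < n) (y - f k ** y)) <= \sum_(k < n) rnorm y.
    elim/big_ind2 : _ => //; first by rewrite rnorm0.
    by move=> x1 x2 y1 y2 ? ?; apply: le_trans (rnormD _ _) _; rewrite lerD.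
  by rewrite sumr_const card_ord.
exists e; split=> //; clearbody e.
rewrite -rnorm_cstar starB starM es js.
have -> : (j - e ** j) ** (j - j ** e) =
    (t ^- 2)%:C *: ((a - a ** e) - e ** (a - a ** e)).
  have aE : a = (t ^+ 2)%:C *: (j ** j).
    by rewrite ahh /h cmulZl cmulZr scalerA -rmorphM -expr2.
  have jj : j ** j = (t ^- 2)%:C *: a.
    by rewrite aE scalerA -rmorphM /= mulVf ?scale1r// expf_neq0// gt_eqF.
  have jje : j ** (j - j ** e) = (t ^- 2)%:C *: (a - a ** e).
    by rewrite cmulBr cmulA jj cmulZl -scalerBr.
  by rewrite cmulBl -cmulA jje cmulZr -scalerBr.
rewrite rnormZr ger0_norm ?invr_ge0 ?exprn_ge0 ?(ltW t0)//.
apply: le_trans nlarge; rewrite ler_wpM2l ?invr_ge0 ?exprn_ge0 ?(ltW t0)//.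
apply: le_trans (ec _) _; rewrite ae rnormZr gtr0_norm ?invr_gt0// mulrC.
by rewrite ler_wpM2r ?invr_ge0// ltW.
Qed.

(* This becomes the C*-identity of the quotient norm. *)
Lemma ideal_cstar_bound (x j : A) (eps : R) : S j -> 0 < eps ->
  exists2 i, S i & rnorm (x + i) ^+ 2 <= rnorm (star x ** x + j) + eps.
Proof.
move=> Sj eps0.
(* An approximate unit is available only for self-adjoint elements. As [star x ** x] is
   self-adjoint, passing to real parts replaces [j] by [k] without increasing the norm. *)
pose k := (2^-1 : R)%:C *: (j + star j).
have Sk : S k by apply: (csiZ hS); apply: (csiD hS) => //; exact: csi_star hS _ Sj.
have ks : star k = k by rewrite starZr starD starK addrC.
have xk : rnorm (star x ** x + k) <= rnorm (star x ** x + j).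
  have -> : star x ** x + k =
    (2^-1 : R)%:C *: ((star x ** x + j) + star (star x ** x + j)).
    by rewrite starD starM starK addrACA scalerDr scale_halfD.
  rewrite rnormZr ger0_norm ?invr_ge0// ler_pdivrMl// mulr_natl mulr2n.
  by apply: le_trans (rnormD _ _) _; rewrite rnorm_star.
have [e [Se es ec ke]] := ideal_approx_unit Sk ks (exprn_gt0 2 eps0).
have ec' y : rnorm (y - y ** e) <= rnorm y.
  by rewrite -rnorm_star starB starM es; apply: le_trans (ec _) _; rewrite rnorm_star.
(* The square to bound is the norm of (1 - e) b (1 - e) with b = x^* x. Writing b as (b + k) - k,
   the first part is controlled by contractivity of 1 - e and the second by k - ke being small. *)
exists (- (x ** e)); first by apply: csiN; exact: (csiMl hS).
rewrite -rnorm_cstar starB starM es.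
set b := star x ** x.
have -> : (star x - e ** star x) ** (x - x ** e) = (b - b ** e) - e ** (b - b ** e).
  by rewrite cmulBl -!cmulA !cmulBr (cmulA (star x)).
apply: le_trans (ec _) _.
have -> : b - b ** e = ((b + k) - (b + k) ** e) - (k - k ** e).
  by rewrite cmulDl opprD addrACA addrK.
apply: le_trans (rnormB _ _) _; apply: lerD; first exact: le_trans (ec' _) xk.
by rewrite -(@ler_pXn2r _ 2)// nnegrE ?rnorm_ge0// ltW.
Qed.

End Ideals.

Section QuotientModule.
Variables (R : realType) (A : cstarAlgType R) (S : set A).
Hypothesis hS : closed_star_ideal S.

(** The proof is an argument of the predicate so that its closure structure, and with it the
    quotient type, can be inferred from [ideal_pred hS]. *)
Definition ideal_pred of closed_star_ideal S : {pred A} := fun x => `[< S x >].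

Lemma ideal_pred_zmod_closed : zmod_closed (ideal_pred hS).
Proof.
split; first by apply/asboolP; exact: csi0 hS.
by move=> x y /asboolP Sx /asboolP Sy; apply/asboolP; exact: csiB.
Qed.

HB.instance Definition _ := GRing.isZmodClosed.Build A (ideal_pred hS) ideal_pred_zmod_closed.

Definition cquot := {ideal_quot (ideal_pred hS)}.

HB.instance Definition _ := GRing.Zmodule.on cquot.

Definition cquot_pi (x : A) : cquot := (\pi x)%qT.
Definition cquot_repr (q : cquot) : A := repr q.

Lemma cquot_reprK q : cquot_pi (cquot_repr q) = q.
Proof. exact: reprK. Qed.

Lemma cquot_piP x y : cquot_pi x = cquot_pi y <-> S (x - y).
Proof.
split=> [/eqP|Sxy].
  by rewrite -Quotient.idealrBE => /asboolP.
by apply/eqP; rewrite -Quotient.idealrBE; apply/asboolP.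
Qed.

Lemma cquot_piD x y : cquot_pi (x + y) = cquot_pi x + cquot_pi y.
Proof. exact: Quotient.pi_add. Qed.

Lemma cquot_piN x : cquot_pi (- x) = - cquot_pi x.
Proof. exact: Quotient.pi_opp. Qed.

Lemma cquot_piB x y : cquot_pi (x - y) = cquot_pi x - cquot_pi y.
Proof. by rewrite cquot_piD cquot_piN. Qed.

Lemma cquot_pi0 : cquot_pi 0 = 0.
Proof. by apply: (@addrI _ (cquot_pi 0)); rewrite -cquot_piD !addr0. Qed.

Lemma cquot_pi_eq0 x : cquot_pi x = 0 <-> S x.
Proof. by rewrite -cquot_pi0 cquot_piP subr0. Qed.

Definition cquot_scale (a : R[i]) (q : cquot) : cquot := cquot_pi (a *: cquot_repr q).

Lemma cquot_repr_pi x : S (cquot_repr (cquot_pi x) - x).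
Proof. by apply/cquot_piP; rewrite cquot_reprK. Qed.

Lemma cquot_scale_pi a x : cquot_scale a (cquot_pi x) = cquot_pi (a *: x).
Proof. by apply/cquot_piP; rewrite -scalerBr; apply: (csiZ hS); exact: cquot_repr_pi. Qed.

Lemma cquot_ind (P : cquot -> Prop) : (forall x, P (cquot_pi x)) -> forall q, P q.
Proof. by move=> h q; rewrite -(cquot_reprK q). Qed.

Lemma cquot_scaleA a b q : cquot_scale a (cquot_scale b q) = cquot_scale (a * b) q.
Proof. by elim/cquot_ind: q => x; rewrite !cquot_scale_pi scalerA. Qed.

Lemma cquot_scale1 : left_id 1 cquot_scale.
Proof. by elim/cquot_ind => x; rewrite cquot_scale_pi scale1r. Qed.

Lemma cquot_scaleDr : right_distributive cquot_scale +%R.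
Proof.
move=> a; elim/cquot_ind => x; elim/cquot_ind => y.
by rewrite -cquot_piD !cquot_scale_pi scalerDr cquot_piD.
Qed.

Lemma cquot_scaleDl q : {morph cquot_scale^~ q : a b / a + b}.
Proof. by move=> a b; elim/cquot_ind: q => x; rewrite !cquot_scale_pi scalerDl cquot_piD. Qed.

HB.instance Definition _ := GRing.Zmodule_isLmodule.Build R[i] cquot
  cquot_scaleA cquot_scale1 cquot_scaleDr cquot_scaleDl.

Lemma cquot_piZ a x : cquot_pi (a *: x) = a *: cquot_pi x.
Proof. by rewrite -cquot_scale_pi. Qed.

Definition cquot_norm (q : cquot) : R := inf [set rnorm x | x in [set x | cquot_pi x = q]].

Lemma cquot_norm_has_inf q : has_inf [set rnorm x | x in [set x | cquot_pi x = q]].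
Proof.
split; first by exists (rnorm (cquot_repr q)); exists (cquot_repr q) => //; exact: cquot_reprK.
by exists 0 => _ [x _ <-]; exact: rnorm_ge0.
Qed.

Lemma cquot_norm_pi x : cquot_norm (cquot_pi x) <= rnorm x.
Proof. by apply: ge_inf; [exact: (cquot_norm_has_inf _).2 | exists x]. Qed.

Lemma cquot_norm_lift q (eps : R) : 0 < eps ->
  exists2 x, cquot_pi x = q & rnorm x < cquot_norm q + eps.
Proof. by move=> e0; have [_ [x xq <-] h] := inf_adherent e0 (cquot_norm_has_inf q); exists x. Qed.

Lemma cquot_norm_ge0 q : 0 <= cquot_norm q.
Proof.
apply: lb_le_inf; first exact: (cquot_norm_has_inf q).1.
by move=> _ [x _ <-]; exact: rnorm_ge0.
Qed.

Lemma cquot_normD p q : cquot_norm (p + q) <= cquot_norm p + cquot_norm q.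
Proof.
apply/ler_addgt0Pr => e e0; have e2 : 0 < e / 2 by rewrite divr_gt0.
have [x xp hx] := cquot_norm_lift p e2; have [y yq hy] := cquot_norm_lift q e2.
rewrite -xp -yq -cquot_piD; apply: le_trans (cquot_norm_pi _) _.
apply: le_trans (rnormD _ _) _; rewrite xp yq; lra.
Qed.

Lemma cquot_norm0 : cquot_norm 0 = 0.
Proof.
apply/eqP; rewrite eq_le cquot_norm_ge0 andbT -cquot_pi0.
by apply: le_trans (cquot_norm_pi _) _; rewrite rnorm0.
Qed.

Lemma cquot_normZ a q : cquot_norm (a *: q) = complex.Re `|a| * cquot_norm q.
Proof.
have le b p : cquot_norm (b *: p) <= complex.Re `|b| * cquot_norm p.
  have b0 : 0 <= complex.Re `|b| by rewrite -ler0c RRe_real ?normr_real.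
  apply/ler_addgt0Pr => e e0.
  have b1 : 0 < complex.Re `|b| + 1 by rewrite ltr_wpDl.
  have [x xp hx] := cquot_norm_lift p (divr_gt0 e0 b1).
  rewrite -xp -cquot_piZ; apply: le_trans (cquot_norm_pi _) _.
  rewrite rnormZ xp; apply: le_trans (ler_wpM2l b0 (ltW hx)) _.
  rewrite mulrDr lerD2l mulrCA ler_piMr ?(ltW e0)//.
  by rewrite ler_pdivrMr// mul1r lerDl.
have [->|a0] := eqVneq a 0; first by rewrite scale0r cquot_norm0 normr0 mul0r.
apply/eqP; rewrite eq_le le /=.
have := le a^-1 (a *: q); rewrite scalerA mulVf// scale1r normfV.
have an : `|a| = (complex.Re `|a|)%:C by rewrite RRe_real ?normr_real.
have ap : 0 < complex.Re `|a| by rewrite -ltcR -an normr_gt0.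
have -> : complex.Re `|a|^-1 = (complex.Re `|a|)^-1.
  by rewrite {1}an -(fmorphV (real_complex R)).
by rewrite ler_pdivlMl.
Qed.

(** Closedness of [S] enters here: lifts [y] of small norm give elements [x - y] of [S] arbitrarily
    near [x]. *)
Lemma cquot_norm_eq0 q : cquot_norm q = 0 -> q = 0.
Proof.
elim/cquot_ind: q => x x0; apply/cquot_pi_eq0.
apply: ((closed_rnormP S).1 (csi_closed hS) x) => e e0.
have [y yx] := cquot_norm_lift (cquot_pi x) e0; rewrite x0 add0r => hy.
exists (x - y); last by rewrite subKr.
by apply/cquot_piP.
Qed.

Definition cquot_cnorm (q : cquot) : R[i] := (cquot_norm q)%:C.

Lemma cquot_cnormD p q : cquot_cnorm (p + q) <= cquot_cnorm p + cquot_cnorm q.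
Proof. by rewrite /cquot_cnorm -rmorphD lecR cquot_normD. Qed.

Lemma cquot_cnormZ a q : cquot_cnorm (a *: q) = `|a| * cquot_cnorm q.
Proof. by rewrite /cquot_cnorm cquot_normZ -[X in _ = X * _](RRe_real (normr_real a)) rmorphM. Qed.

Lemma cquot_cnorm_eq0 q : cquot_cnorm q = 0 -> q = 0.
Proof. by move=> /complexI; exact: cquot_norm_eq0. Qed.

HB.instance Definition _ := Lmodule_isNormed.Build R[i] cquot
  cquot_cnormD cquot_cnormZ cquot_cnorm_eq0.

Lemma rnorm_cquot (q : cquot) : rnorm q = cquot_norm q.
Proof. by []. Qed.

End QuotientModule.

Section QuotientAlgebra.
Variables (R : realType) (A : cstarAlgType R) (S : set A).
Hypothesis hS : closed_star_ideal S.

Notation Q := (cquot hS).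
Notation pi := (cquot_pi hS).

(* Successive differences of a Cauchy sequence are lifted with control of the norm. *)
Lemma cquot_complete (F : set_system Q) : ProperFilter F -> cauchy F -> cvg F.
Proof.
move=> FF /cauchyP Fc.
pose d n : R := 2^-1 ^+ n.
have d0 n : 0 < d n by rewrite exprn_gt0// invr_gt0.
(* A sequence replaces the filter: the balls around [q n] and [q n.+1] both belong to [F], hence
   meet, which bounds the distance of their centres. *)
have /choice[q hq] n : exists q, F (ball q (d n)%:C) by apply: Fc; rewrite ltcR.
have qq n : rnorm (q n.+1 - q n) < 2 * d n.
  have [r [/rnorm_ballE h1 /rnorm_ballE h2]] := filter_ex (filterI (hq n.+1) (hq n)).
  apply: le_lt_trans (rnorm_triangle r _ _) _.
  rewrite (rnormBC r); have : d n.+1 <= d n.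
    by rewrite /d exprS ler_piMl ?(ltW (d0 n))//; lra.
  lra.
(* The 3 is the 2 of [qq] plus one [d n] of slack, since the infimum defining the quotient norm need
   not be attained. *)
have /choice[z hz] n : exists z, pi z = q n.+1 - q n /\ rnorm z < 3 * d n.
  have [z z1 z2] := cquot_norm_lift (q n.+1 - q n) (d0 n).
  by exists z; split=> //; have := qq n; rewrite rnorm_cquot; lra.
pose x n := cquot_repr (q 0) + \sum_(k < n) z k.
have px n : pi (x n) = q n.
  rewrite /x; elim: n => [|n IH]; first by rewrite big_ord0 addr0 cquot_reprK.
  by rewrite big_ord_recr /= addrA cquot_piD IH (hz n).1 addrC subrK.
have /cvg_ex[l xl] : cvgn x.
  apply: (@geometric_cauchy_cvg _ _ x 3 2^-1); first by apply/andP; split; lra.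
  by move=> n; rewrite /x big_ord_recr /= addrA [_ + z n]addrC addrK; exact: ltW (hz n).2.
apply/cvg_ex; exists (pi l); apply/cvg_rnormP => e e0.
have e2 : 0 < e / 2 by rewrite divr_gt0.
have [N1 h1] := cvg_rnorm_seq xl e2.
have [N2 _ h2] : \forall n \near \oo, d n < e / 2.
  have : d @ \oo --> 0 by apply: cvg_expr; rewrite ger0_norm; lra.
  move=> /cvgrPdist_lt /(_ _ e2); apply: filterS => n.
  by rewrite sub0r normrN gtr0_norm.
pose n := maxn N1 N2.
apply: filterS (hq n) => r /rnorm_ballE hr.
apply: le_lt_trans (rnorm_triangle (q n) _ _) _.
have : rnorm (pi l - q n) < e / 2.
  rewrite -px -cquot_piB; apply: le_lt_trans (cquot_norm_pi _ _) _.
  by apply: h1; rewrite leq_maxl.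
have := h2 n (leq_maxr _ _); rewrite /=; lra.
Qed.

HB.instance Definition _ := Uniform_isComplete.Build Q cquot_complete.

Definition cquot_mul (p q : Q) : Q := pi (cquot_repr p ** cquot_repr q).
Definition cquot_star (q : Q) : Q := pi (star (cquot_repr q)).

Lemma cquot_mul_pi x y : cquot_mul (pi x) (pi y) = pi (x ** y).
Proof.
apply/cquot_piP; have hx := cquot_repr_pi hS x; have hy := cquot_repr_pi hS y.
set x' := cquot_repr _ in hx *; set y' := cquot_repr _ in hy *.
have -> : x' ** y' - x ** y = (x' - x) ** y' + x ** (y' - y).
  by rewrite cmulBl cmulBr addrA subrK.
by apply: (csiD hS); [exact: csiMr | exact: (csiMl hS)].
Qed.

Lemma cquot_star_pi x : cquot_star (pi x) = pi (star x).
Proof. by apply/cquot_piP; rewrite -starB; apply: (csi_star hS); exact: cquot_repr_pi. Qed.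

Let elimq := (@cquot_ind R A S hS).

Let mulA p q r : cquot_mul p (cquot_mul q r) = cquot_mul (cquot_mul p q) r.
Proof.
by elim/elimq: p => x; elim/elimq: q => y; elim/elimq: r => z; rewrite !cquot_mul_pi cmulA.
Qed.

Let mulDl p q r : cquot_mul (p + q) r = cquot_mul p r + cquot_mul q r.
Proof.
elim/elimq: p => x; elim/elimq: q => y; elim/elimq: r => z.
by rewrite -cquot_piD !cquot_mul_pi cmulDl cquot_piD.
Qed.

Let mulDr p q r : cquot_mul p (q + r) = cquot_mul p q + cquot_mul p r.
Proof.
elim/elimq: p => x; elim/elimq: q => y; elim/elimq: r => z.
by rewrite -cquot_piD !cquot_mul_pi cmulDr cquot_piD.
Qed.

Let mulZl (a : R[i]) p q : cquot_mul (a *: p) q = a *: cquot_mul p q.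
Proof.
by elim/elimq: p => x; elim/elimq: q => y; rewrite -cquot_piZ !cquot_mul_pi cmulZl cquot_piZ.
Qed.

Let mulZr (a : R[i]) p q : cquot_mul p (a *: q) = a *: cquot_mul p q.
Proof.
by elim/elimq: p => x; elim/elimq: q => y; rewrite -cquot_piZ !cquot_mul_pi cmulZr cquot_piZ.
Qed.

Let starK' q : cquot_star (cquot_star q) = q.
Proof. by elim/elimq: q => x; rewrite !cquot_star_pi starK. Qed.

Let starD' p q : cquot_star (p + q) = cquot_star p + cquot_star q.
Proof.
by elim/elimq: p => x; elim/elimq: q => y; rewrite -cquot_piD !cquot_star_pi starD cquot_piD.
Qed.

Let starZ' (a : R[i]) q : cquot_star (a *: q) = a^* *: cquot_star q.
Proof. by elim/elimq: q => x; rewrite -cquot_piZ !cquot_star_pi starZ cquot_piZ. Qed.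

Let starM' p q : cquot_star (cquot_mul p q) = cquot_mul (cquot_star q) (cquot_star p).
Proof.
by elim/elimq: p => x; elim/elimq: q => y; rewrite !(cquot_mul_pi, cquot_star_pi) starM.
Qed.

Let rnormM' p q : rnorm (cquot_mul p q) <= rnorm p * rnorm q.
Proof.
apply/ler_addgt0Pr => e e0.
(* For d at most 1, (|p| + d)(|q| + d) exceeds |p||q| by at most d (|p| + |q| + 1), so d at most e /
   c keeps the excess below e. *)
pose c := rnorm p + rnorm q + 1.
have p0 := rnorm_ge0 p; have q0 := rnorm_ge0 q.
pose d := Num.min 1 (e / c).
have c0 : 0 < c by rewrite /c; lra.
have d0 : 0 < d by rewrite lt_min ltr01 divr_gt0.
have d1 : d <= 1 by rewrite ge_min lexx.
have dc : d * c <= e by rewrite -ler_pdivlMr// ge_min lexx orbT.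
have [x xp hx] := cquot_norm_lift p d0; have [y yq hy] := cquot_norm_lift q d0.
have -> : cquot_mul p q = pi (x ** y) by rewrite -cquot_mul_pi xp yq.
apply: le_trans (cquot_norm_pi _ _) _; apply: le_trans (rnormM _ _) _.
apply: le_trans (ler_pM (rnorm_ge0 _) (rnorm_ge0 _) (ltW hx) (ltW hy)) _.
rewrite -!rnorm_cquot; apply: le_trans (_ : _ <= rnorm p * rnorm q + d * c) _; last by rewrite lerD2l.
by rewrite /c; nra.
Qed.

Let normM p q : `|cquot_mul p q| <= `|p| * `|q|.
Proof. by rewrite !rnormE -rmorphM lecR rnormM'. Qed.

Let rnorm_le q : rnorm q ^+ 2 <= rnorm (cquot_mul (cquot_star q) q).
Proof.
elim/elimq: q => x; rewrite cquot_star_pi cquot_mul_pi.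
apply/ler_addgt0Pr => e e0; have e2 : 0 < e / 2 by rewrite divr_gt0.
have [y yx hy] := cquot_norm_lift (pi (star x ** x)) e2.
have Sj : S (y - star x ** x) by apply/cquot_piP.
have [i Si] := ideal_cstar_bound hS x Sj e2.
rewrite [_ + (y - _)]addrC subrK => h.
have -> : pi x = pi (x + i) by apply/cquot_piP; rewrite opprD addrA subrr sub0r; exact: csiN.
have : rnorm (pi (x + i)) ^+ 2 <= rnorm (x + i) ^+ 2.
  by rewrite ler_pXn2r// ?nnegrE ?rnorm_ge0// cquot_norm_pi.
by rewrite -rnorm_cquot in hy; lra.
Qed.

Let rnorm_star_le q : rnorm (cquot_star q) <= rnorm q.
Proof.
apply/ler_addgt0Pr => e e0; have [x xq hx] := cquot_norm_lift q e0.
rewrite -xq cquot_star_pi; apply: le_trans (cquot_norm_pi _ _) _.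
by rewrite rnorm_star xq ltW.
Qed.

Let norm_star q : `|cquot_mul (cquot_star q) q| = `|q| ^+ 2.
Proof.
rewrite !rnormE -rmorphXn; congr (_%:C); apply/eqP; rewrite eq_le rnorm_le andbT.
by apply: le_trans (rnormM' _ _) _; rewrite expr2 ler_wpM2r ?rnorm_ge0 ?rnorm_star_le.
Qed.

HB.instance Definition _ := isCstarAlgebra.Build R Q
  mulA mulDl mulDr mulZl mulZr starK' starD' starZ' starM' normM norm_star.

Lemma cquot_pi_hom : star_hom pi.
Proof.
split=> [a x y|x y|x]; first by rewrite cquot_piD cquot_piZ.
  by rewrite -cquot_mul_pi.
by rewrite -cquot_star_pi.
Qed.

End QuotientAlgebra.

Lemma csi_kernel (R : realType) (A B : cstarAlgType R) (f : A -> B) :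
  star_hom f -> closed_star_ideal [set x | f x = 0].
Proof.
move=> hf; split=> /=.
- by rewrite star_hom0.
- by move=> x y fx fy; rewrite star_homD// fx fy addr0.
- by move=> a x fx; rewrite star_homZ// fx scaler0.
- by move=> x y fy; rewrite (star_homM hf) fy cmulx0.
- by move=> x fx; rewrite (star_hom_star hf) fx star0.
- apply: closed_equalizer; first exact: star_hom_continuous.
  by move=> x; exact: cvg_cst.
Qed.

Lemma cquot_factor (R : realType) (A B : cstarAlgType R) (S : set A) (hS : closed_star_ideal S)
    (f : A -> B) : star_hom f -> (forall x, S x -> f x = 0) ->
  exists2 g : cquot hS -> B, star_hom g & forall x, g (cquot_pi hS x) = f x.
Proof.
move=> hf fS; pose g (q : cquot hS) := f (cquot_repr q).
have gpi x : g (cquot_pi hS x) = f x.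
  by apply/eqP; rewrite /g -subr_eq0 -(star_homB hf); apply/eqP/fS; exact: cquot_repr_pi.
have hpi := cquot_pi_hom hS.
exists g => //; split.
- move=> a; elim/cquot_ind => x; elim/cquot_ind => y.
  by rewrite -(star_hom_linear hpi) !gpi (star_hom_linear hf).
- elim/cquot_ind => x; elim/cquot_ind => y.
  by rewrite -(star_homM hpi) !gpi (star_homM hf).
- by elim/cquot_ind => x; rewrite -(star_hom_star hpi) !gpi (star_hom_star hf).
Qed.

(** * Maps between graph algebras *)

Section FiniteSums.
Variables (I : choiceType) (V W : zmodType).

Lemma fsum_morph (f : V -> W) (D : set I) (u : I -> V) :
  finite_set D -> f 0 = 0 -> {morph f : x y / x + y} ->
  f (\sum_(i \in D) u i) = \sum_(i \in D) f (u i).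
Proof. by move=> finD f0 fD; rewrite !fsbig_finite// (big_morph f fD f0). Qed.

Lemma fsum_ind (P : V -> Prop) (D : set I) (u : I -> V) :
  finite_set D -> P 0 -> (forall x y, P x -> P y -> P (x + y)) ->
  (forall i, D i -> P (u i)) -> P (\sum_(i \in D) u i).
Proof.
move=> finD P0 PD Pu; rewrite fsbig_finite// big_seq; apply: (big_ind P) => // i.
by rewrite in_fset_set// inE; exact: Pu.
Qed.

Lemma fsumB_subset (D1 D2 : set I) (u : I -> V) : finite_set D2 -> D1 `<=` D2 ->
  \sum_(i \in D2) u i - \sum_(i \in D1) u i = \sum_(i \in D2 `\` D1) u i.
Proof.
move=> fin2 D12; rewrite (fsbigID D1)//= setIidr// addrAC subrr add0r.
by rewrite setDE.
Qed.

End FiniteSums.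

Section CuntzKrieger.
Variables (R : realType) (E : digraph) (F : subgraph E) (A : cstarAlgType R).
Variables (p : vertex E -> A) (s : edge E -> A).
Hypothesis CK : CK_family F p s.

Definition out_proj v : A := \sum_(e \in out F v) (s e ** star (s e)).
(** If edges outside [F] have range outside [F], this is, at a breaking vertex, the gap projection
    p_v^H of the ideal theory of graph algebras, with H the set of vertices outside [F]. *)
Definition gap v : A := p v - out_proj v.

Lemma CK_p_star v : verts F v -> star (p v) = p v.
Proof. by move=> /(CK_proj CK)[]. Qed.

Lemma CK_p_idem v : verts F v -> p v ** p v = p v.
Proof. by move=> /(CK_proj CK)[]. Qed.

Lemma CK_ps e : edges F e -> p (src e) ** s e = s e.
Proof.
move=> Fe; have := CK_range CK Fe; rewrite /proj_le => h.
by rewrite -{1}(CK_isom CK Fe) cmulA h (CK_isom CK Fe).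
Qed.

Lemma CK_sp e : edges F e -> s e ** p (rng e) = s e.
Proof. by move=> Fe; rewrite -(CK_source CK Fe) cmulA (CK_isom CK Fe). Qed.

Lemma CK_p_star_s e : edges F e -> p (rng e) ** star (s e) = star (s e).
Proof.
move=> Fe; rewrite -{1}(CK_p_star (edges_rng Fe)) -starM; congr star.
exact: CK_sp.
Qed.

Lemma CK_ps0 v e : verts F v -> edges F e -> v <> src e -> p v ** s e = 0.
Proof.
move=> Fv Fe ve; rewrite -(CK_ps Fe) cmulA (CK_proj_orth CK) ?cmul0x//.
exact: edges_src.
Qed.

Lemma CK_star_ss0 e f : edges F e -> edges F f -> e <> f -> star (s e) ** s f = 0.
Proof.
move=> Fe Ff ef; rewrite -(CK_isom CK Ff).
have -> : star (s e) = star (s e) ** s e ** star (s e).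
  by rewrite -[in LHS](CK_isom CK Fe) !starM starK cmulA.
by rewrite -!cmulA (cmulA (s e)) (cmulA (s f)) (cmulA (s e ** _))
  (CK_range_orth CK Fe Ff ef) cmul0x cmulx0.
Qed.

End CuntzKrieger.

Section GraphAlgebraMaps.
Variables (R : realType) (E : digraph).
Implicit Types F G H : subgraph E.

Lemma gc_hom_ext F (A : graph_cstar R F) (B : cstarAlgType R) (f g : A -> B) :
  star_hom f -> star_hom g ->
  (forall v, verts F v -> f (gc_p A v) = g (gc_p A v)) ->
  (forall e, edges F e -> f (gc_s A e) = g (gc_s A e)) -> forall x, f x = g x.
Proof.
move=> hf hg hp hs x.
suff : [set x | f x = g x] x by [].
by rewrite (gc_generated (css_equalizer hf hg) hp hs).
Qed.

(** Surjectivity is left out because the universal property yields only the values on generators;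
    [canonical_hom_surjective] recovers it. *)
Record canonical_hom F G (A : graph_cstar R F) (B : graph_cstar R G) (f : A -> B) : Prop := {
  ch_hom : star_hom f;
  ch_p : forall v, verts G v -> f (gc_p A v) = gc_p B v;
  ch_p0 : forall v, verts F v -> ~ verts G v -> f (gc_p A v) = 0;
  ch_s : forall e, edges G e -> f (gc_s A e) = gc_s B e;
  ch_s0 : forall e, edges F e -> ~ edges G e -> f (gc_s A e) = 0
}.

Lemma canonical_hom_unique F G (A : graph_cstar R F) (B : graph_cstar R G) (f g : A -> B) :
  canonical_hom f -> canonical_hom g -> forall x, f x = g x.
Proof.
move=> hf hg; apply: gc_hom_ext; [exact: ch_hom | exact: ch_hom | |] => [v Fv|e Fe].
  have [Gv|Gv] := pselect (verts G v); first by rewrite (ch_p hf)// (ch_p hg).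
  by rewrite (ch_p0 hf)// (ch_p0 hg).
have [Ge|Ge] := pselect (edges G e); first by rewrite (ch_s hf)// (ch_s hg).
by rewrite (ch_s0 hf)// (ch_s0 hg).
Qed.

Lemma canonical_hom_comp F G H (A : graph_cstar R F) (B : graph_cstar R G) (C : graph_cstar R H)
    (f : A -> B) (g : B -> C) : verts H `<=` verts G -> edges H `<=` edges G ->
  canonical_hom f -> canonical_hom g -> canonical_hom (fun x => g (f x)).
Proof.
move=> sv se hf hg; split.
- exact: star_hom_comp (ch_hom hf) (ch_hom hg).
- by move=> v Hv; rewrite (ch_p hf) ?(ch_p hg)//; exact: sv.
- move=> v Fv Hv; have [Gv|Gv] := pselect (verts G v); first by rewrite (ch_p hf)// (ch_p0 hg).
  by rewrite (ch_p0 hf)// (star_hom0 (ch_hom hg)).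
- by move=> e He; rewrite (ch_s hf) ?(ch_s hg)//; exact: se.
- move=> e Fe He; have [Ge|Ge] := pselect (edges G e); first by rewrite (ch_s hf)// (ch_s0 hg).
  by rewrite (ch_s0 hf)// (star_hom0 (ch_hom hg)).
Qed.

(* The conditions under which killing F \ G maps C*(F) to C*(G). *)
Record quotient_subgraph F G : Prop := {
  qs_verts : verts G `<=` verts F;
  qs_edges : edges G `<=` edges F;
  qs_rng : forall e, edges F e -> verts G (rng e) -> edges G e;
  qs_reg : forall v, reg F v -> verts G v -> reg G v
}.

(** The generators of G, extended by zero, form a Cuntz-Krieger family for F. [qs_rng] is the source
    relation at an edge sent to 0, whose range projection must vanish too; [qs_reg] makes the sum
    relation at v available in C*(G). *)
Lemma canonical_hom_exists F G (A : graph_cstar R F) (B : graph_cstar R G) :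
  quotient_subgraph F G -> exists f : A -> B, canonical_hom f.
Proof.
move=> qs; have CB := gc_family B.
pose q v : B := if pselect (verts G v) then gc_p B v else 0.
pose t e : B := if pselect (edges G e) then gc_s B e else 0.
have qE v : verts G v -> q v = gc_p B v by rewrite /q; case: pselect.
have q0 v : ~ verts G v -> q v = 0 by rewrite /q; case: pselect.
have tE e : edges G e -> t e = gc_s B e by rewrite /t; case: pselect.
have t0 e : ~ edges G e -> t e = 0 by rewrite /t; case: pselect.
have CK : CK_family F q t.
  split.
  - move=> v Fv; have [Gv|Gv] := pselect (verts G v).
      by rewrite qE//; exact: CK_proj CB _ Gv.
    by rewrite q0//; split; rewrite ?star0 ?cmul0x.
  - move=> v w Fv Fw vw; have [Gv|Gv] := pselect (verts G v); last by rewrite q0// cmul0x.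
    have [Gw|Gw] := pselect (verts G w); last by rewrite [q w]q0// cmulx0.
    by rewrite !qE// (CK_proj_orth CB).
  - move=> e Fe; have [Ge|Ge] := pselect (edges G e).
      by rewrite tE//; exact: CK_isom CB _ Ge.
    by rewrite t0// /partial_isometry !cmul0x.
  - move=> e f Fe Ff ef; have [Ge|Ge] := pselect (edges G e); last by rewrite t0// !cmul0x.
    have [Gf|Gf] := pselect (edges G f); last by rewrite [t f]t0// !cmul0x cmulx0.
    by rewrite !tE// (CK_range_orth CB).
  - move=> e Fe; have [Ge|Ge] := pselect (edges G e).
      by rewrite tE// qE ?(CK_source CB)//; exact: edges_rng.
    by rewrite t0// cmulx0 q0// => /(qs_rng qs Fe).
  - move=> e Fe; have [Ge|Ge] := pselect (edges G e).
      by rewrite tE// qE; [exact: CK_range CB _ Ge | exact: edges_src].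
    by rewrite t0// /proj_le cmul0x cmulx0.
  - move=> v rv; have [Fv _ finv] := rv.
    have [Gv|Gv] := pselect (verts G v); last first.
      rewrite q0// fsbig1// => e [Fe ev]; rewrite t0 ?cmul0x// => Ge.
      by apply: Gv; rewrite -ev; exact: edges_src.
    rewrite qE// (CK_sum CB (qs_reg qs rv Gv)).
    under eq_fsbigr => e /set_mem[Ge _] do rewrite -(tE e Ge).
    apply: fsbig_widen => [e [/(qs_edges qs)]//|e [[Fe ev] nGe]] /=.
    by rewrite t0 ?cmul0x// => Ge; apply: nGe.
have [f [hf fp fs]] := gc_universal A CK.
exists f; split=> //.
- by move=> v Gv; rewrite fp ?qE//; exact: qs_verts Gv.
- by move=> v Fv Gv; rewrite fp ?q0.
- by move=> e Ge; rewrite fs ?tE//; exact: qs_edges Ge.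
- by move=> e Fe Ge; rewrite fs ?t0.
Qed.

(* The conditions say that the family indexed by G in the quotient by S is a
   Cuntz-Krieger family of G. *)
Record relation_ideal F G (A : graph_cstar R F) (S : set A) : Prop := {
  ri_ideal : closed_star_ideal S;
  ri_p : forall v, verts F v -> ~ verts G v -> S (gc_p A v);
  ri_s : forall e, edges F e -> ~ edges G e -> S (gc_s A e);
  ri_gap : forall v, reg G v -> S (gap G (gc_p A) (gc_s A) v)
}.

(** The universal property of C*(G) provides [g], and [g] after [f] agrees with the quotient map on
    generators. So [g] inverts [f] modulo [S], which bounds the kernel of [f] and also yields
    surjectivity. *)
Lemma relation_ideal_section F G (A : graph_cstar R F) (B : graph_cstar R G) (f : A -> B)
    (S : set A) (hS : closed_star_ideal S) :
  verts G `<=` verts F -> edges G `<=` edges F -> canonical_hom f -> relation_ideal G S ->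
  exists g : B -> cquot hS, [/\ star_hom g,
    forall v, verts G v -> g (gc_p B v) = cquot_pi hS (gc_p A v),
    forall e, edges G e -> g (gc_s B e) = cquot_pi hS (gc_s A e) &
    forall x, g (f x) = cquot_pi hS x].
Proof.
move=> sv se hf hG; have CA := gc_family A.
have hpi := cquot_pi_hom hS.
have piM := star_homM hpi; have pis := star_hom_star hpi.
have CK : CK_family G (fun v => cquot_pi hS (gc_p A v)) (fun e => cquot_pi hS (gc_s A e)).
  split.
  - move=> v /sv Fv; have [h1 h2] := CK_proj CA Fv.
    by split; rewrite -?pis -?piM ?h1 ?h2.
  - by move=> v w /sv Fv /sv Fw vw; rewrite -piM (CK_proj_orth CA)// (star_hom0 hpi).
  - by move=> e /se Fe; rewrite /partial_isometry -pis -!piM (CK_isom CA Fe).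
  - by move=> e f' /se Fe /se Ff ef; rewrite -!pis -!piM (CK_range_orth CA)// (star_hom0 hpi).
  - by move=> e /se Fe; rewrite -pis -piM (CK_source CA Fe).
  - by move=> e /se Fe; rewrite /proj_le -pis -!piM (CK_range CA Fe).
  - move=> v rv; have [_ _ finv] := rv.
    under eq_fsbigr => e _ do rewrite -pis -piM.
    rewrite -(fsum_morph _ finv (star_hom0 hpi) (star_homD hpi)).
    by apply/cquot_piP; exact: ri_gap hG _ rv.
have [g [hg gp gs]] := gc_universal B CK.
exists g; split=> //.
apply: gc_hom_ext => //; first exact: star_hom_comp (ch_hom hf) hg.
- move=> v Fv; have [Gv|Gv] := pselect (verts G v); first by rewrite (ch_p hf)// gp.
  rewrite (ch_p0 hf)// (star_hom0 hg); apply/esym/cquot_pi_eq0.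
  exact: ri_p hG _ Fv Gv.
- move=> e Fe; have [Ge|Ge] := pselect (edges G e); first by rewrite (ch_s hf)// gs.
  rewrite (ch_s0 hf)// (star_hom0 hg); apply/esym/cquot_pi_eq0.
  exact: ri_s hG _ Fe Ge.
Qed.

Lemma canonical_hom_kernel F G (A : graph_cstar R F) (B : graph_cstar R G) (f : A -> B)
    (S : set A) : verts G `<=` verts F -> edges G `<=` edges F ->
  canonical_hom f -> relation_ideal G S -> forall x, f x = 0 -> S x.
Proof.
move=> sv se hf hS x fx.
have [g [hg _ _ gf]] := relation_ideal_section (ri_ideal hS) sv se hf hS.
by apply/(cquot_pi_eq0 (ri_ideal hS)); rewrite -gf fx star_hom0.
Qed.

Lemma kernel_relation_ideal F G (A : graph_cstar R F) (B : graph_cstar R G) (f : A -> B) :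
  canonical_hom f -> relation_ideal G [set x | f x = 0].
Proof.
move=> hf; have hom := ch_hom hf; split=> /=.
- exact: csi_kernel.
- exact: ch_p0.
- exact: ch_s0.
- move=> v rv; have [Gv _ finv] := rv.
  rewrite (star_homB hom) (fsum_morph _ finv (star_hom0 hom) (star_homD hom)).
  rewrite (ch_p hf)// (CK_sum (gc_family B) rv); apply/eqP; rewrite subr_eq0; apply/eqP.
  apply: eq_fsbigr => e /set_mem[Ge _].
  by rewrite (star_homM hom) (star_hom_star hom) (ch_s hf).
Qed.

(** Generation alone would require the range to be closed. Instead [f] factors through the quotient
    by its own kernel, and the section into that quotient is a right inverse, as is checked on
    generators. *)
Lemma canonical_hom_surjective F G (A : graph_cstar R F) (B : graph_cstar R G) (f : A -> B) :
  verts G `<=` verts F -> edges G `<=` edges F -> canonical_hom f -> range f = setT.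
Proof.
move=> sv se hf; have hS := csi_kernel (ch_hom hf).
have [g [hg gp gs _]] := relation_ideal_section hS sv se hf (kernel_relation_ideal hf).
have [h hh hpi] := cquot_factor hS (ch_hom hf) (fun x fx => fx).
have hg_id y : h (g y) = y.
  apply: (gc_hom_ext (star_hom_comp hg hh) (star_hom_id B)) => [v Gv|e Ge].
    by rewrite gp// hpi (ch_p hf).
  by rewrite gs// hpi (ch_s hf).
apply/seteqP; split=> // y _; exists (cquot_repr (g y)) => //.
by rewrite -hpi cquot_reprK hg_id.
Qed.

End GraphAlgebraMaps.

(** * The kernels for an admissible decomposition *)

Section Admissible.
Variable E : digraph.
Implicit Types F G : subgraph E.

(* An elementwise form of admissibility that is visibly symmetric. *)
Record admissible F1 F2 : Prop := {
  ad_v : forall v, verts F1 v \/ verts F2 v;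
  ad_e : forall e, edges F1 e \/ edges F2 e;
  ad_sink : forall v, verts F1 v -> verts F2 v ->
    (forall e, edges F1 e -> edges F2 e -> src e <> v) -> ~ reg F1 v /\ ~ reg F2 v;
  ad_rng1 : forall e, edges F1 e -> verts F2 (rng e) -> edges F2 e;
  ad_rng2 : forall e, edges F2 e -> verts F1 (rng e) -> edges F1 e;
  ad_reg : forall v, reg (subgraphI F1 F2) v -> reg F1 v \/ reg F2 v
}.

Lemma admissible_decompositionP F1 F2 : admissible_decomposition F1 F2 -> admissible F1 F2.
Proof.
move=> [cover sinkP e1 e2 regP]; split.
- move=> v; have : verts (subgraphU F1 F2) v by rewrite cover.
  by [].
- move=> e; have : edges (subgraphU F1 F2) e by rewrite cover.
  by [].
- move=> v v1 v2 noe; have : sink (subgraphI F1 F2) v.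
    split=> //; apply/seteqP; split=> // e [[Fe1 Fe2] ev].
    by case: (noe e Fe1 Fe2).
  by move=> /sinkP[[_ ?] [_ ?]].
- move=> e Fe1 r2; have : (edges F1 `&` edges F2) e.
    by rewrite e1; split=> //; split=> //; exact: edges_rng.
  by move=> [].
- move=> e Fe2 r1; have : (edges F1 `&` edges F2) e.
    by rewrite e2; split=> //; split=> //; exact: edges_rng.
  by move=> [].
- move=> v rv; have [r1|r1] := pselect (reg F1 v); first by left.
  by right; apply: regP; split=> //; split=> //; have [[]] := rv.
Qed.

Lemma subgraphI_regC F1 F2 v : reg (subgraphI F1 F2) v -> reg (subgraphI F2 F1) v.
Proof.
move=> [[v1 v2] [e [[e1 e2] ev]] fin]; split=> //; first by exists e.
by apply: sub_finite_set fin => f [[f1 f2] fv].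
Qed.

Lemma admissible_sym F1 F2 : admissible F1 F2 -> admissible F2 F1.
Proof.
move=> ad; split.
- by move=> v; case: (ad_v ad v); [right|left].
- by move=> e; case: (ad_e ad e); [right|left].
- move=> v v2 v1 noe; have [|? ?] := ad_sink ad v1 v2; last by split.
  by move=> e e1 e2; exact: noe.
- exact: ad_rng2.
- exact: ad_rng1.
- by move=> v /subgraphI_regC /(ad_reg ad)[]; [right|left].
Qed.

Section OneSide.
Variables (F1 F2 : subgraph E) (ad : admissible F1 F2).

Lemma out_whole_F1 e : ~ verts F2 (src e) -> edges F1 e.
Proof. by move=> ns; case: (ad_e ad e) => // /edges_src. Qed.

Lemma rng_notin_F1 e : ~ edges F1 e -> ~ verts F1 (rng e).
Proof. by move=> ne r1; case: (ad_e ad e) => // e2; apply: ne; exact: ad_rng2 ad _ e2 r1. Qed.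

(** Otherwise [v] is a sink of the intersection, and condition (b) makes it singular on both
    sides. *)
Lemma exists_common_edge v : verts F1 v -> verts F2 v -> reg F1 v \/ reg F2 v ->
  exists e, [/\ edges F1 e, edges F2 e & src e = v].
Proof.
move=> v1 v2 rv; apply: contrapT => no.
have [|n1 n2] := ad_sink ad v1 v2; last by case: rv.
by move=> e e1 e2 ev; apply: no; exists e.
Qed.

Lemma quotient_subgraph_whole : quotient_subgraph (whole E) F1.
Proof.
split=> //.
- by move=> e _ r1; apply: contrapT => ne; exact: rng_notin_F1 ne r1.
- move=> v [_ [e [_ ev]] fin] v1.
  have fin1 : finite_set (out F1 v) by apply: sub_finite_set fin => f [_ ?].
  (* If the edge [e] leaving [v] is not in [F1], it lies in [F2]. Then [v] is a shared vertex,
     regular in [F2], so a shared edge leaves it. *)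
  split=> //; have [e1|e1] := pselect (edges F1 e); first by exists e.
  have e2 : edges F2 e by case: (ad_e ad e).
  have v2 : verts F2 v by rewrite -ev; exact: edges_src.
  have [|f [f1 _ fv]] := exists_common_edge v1 v2; last by exists f.
  right; split=> //; first by exists e.
  by apply: sub_finite_set fin => f [_ ?].
Qed.

(** [G] is given by its vertex and edge sets so that, after exchanging the two sides, the lemma
    applies to the same [subgraphI F1 F2]. *)
Lemma quotient_subgraph_part G : verts G = verts F1 `&` verts F2 ->
  edges G = edges F1 `&` edges F2 -> quotient_subgraph F1 G.
Proof.
move=> vG eG; split.
- by rewrite vG => v [].
- by rewrite eG => v [].
- by move=> e e1; rewrite vG eG => -[_ r2]; split=> //; exact: ad_rng1 ad _ e1 r2.
- move=> v rv; rewrite vG => -[v1 v2]; have [_ _ fin] := rv.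
  have [|e [e1 e2 ev]] := exists_common_edge v1 v2; first by left.
  split; first by rewrite vG.
    by exists e; split; rewrite ?eG.
  by apply: sub_finite_set fin => f []; rewrite eG => -[].
Qed.

(** Away from [F2] every edge leaving [v] is in [F1], so [v] would emit the same edges in [F1] and
    in [E]. Thus a gap generator of one side sits at a vertex of the other. *)
Lemma breaking_vertex v : reg F1 v -> ~ reg (whole E) v -> verts F2 v.
Proof.
move=> [v1 [e [e1 ev]] fin] nr; apply: contrapT => v2; apply: nr; split=> //; first by exists e.
apply: sub_finite_set fin => f [_ fv]; split=> //; apply: out_whole_F1.
by rewrite fv.
Qed.

Lemma reg_both v : reg F1 v -> reg F2 v -> reg (whole E) v.
Proof.
move=> [v1 [e [e1 ev]] fin1] [_ _ fin2]; split=> //; first by exists e.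
have : finite_set (out F1 v `|` out F2 v) by rewrite finite_setU.
by apply: sub_finite_set => f [_ fv]; case: (ad_e ad f) => ?; [left|right].
Qed.

End OneSide.

End Admissible.

(** * Orthogonality of the ideal generators in C*(E) *)

Section Orthogonality.
Variables (R : realType) (E : digraph) (CE : graph_cstar R (whole E)).
Let p := gc_p CE.
Let s := gc_s CE.
Let CK : CK_family (whole E) p s := gc_family CE.
Implicit Types F : subgraph E.

Notation q F := (out_proj F s).
Notation beta F := (gap F p s).

Let p_star v : star (p v) = p v. Proof. exact: (CK_p_star CK). Qed.
Let p_idem v : p v ** p v = p v. Proof. exact: (CK_p_idem CK). Qed.
Let p_orth v w : v <> w -> p v ** p w = 0. Proof. exact: (CK_proj_orth CK). Qed.
Let ps e : p (src e) ** s e = s e. Proof. exact: (CK_ps CK). Qed.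
Let ps0 v e : v <> src e -> p v ** s e = 0. Proof. exact: (CK_ps0 CK). Qed.
Let sp e : s e ** p (rng e) = s e. Proof. exact: (CK_sp CK). Qed.

Section Gap.
Variables (F : subgraph E) (v : vertex E) (rv : reg F v).
Let fin : finite_set (out F v) := let: And3 _ _ f := rv in f.

Lemma out_proj_s e : out F v e -> q F v ** s e = s e.
Proof.
move=> Fe; rewrite (fsum_morph (f := fun x => x ** s e)) ?cmul0x//.
  rewrite (fsbigD1 e)//= fsbig1 => [|f [_ fe]]; first by rewrite addr0 (CK_isom CK I).
  by rewrite -cmulA (CK_star_ss0 CK)// cmulx0.
by move=> x y; rewrite cmulDl.
Qed.

Lemma out_proj_s0 e : ~ out F v e -> q F v ** s e = 0.
Proof.
move=> Fe; rewrite (fsum_morph (f := fun x => x ** s e)) ?cmul0x//.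
  apply: fsbig1 => f Ff; rewrite -cmulA (CK_star_ss0 CK) ?cmulx0//.
  by move=> fe; apply: Fe; rewrite -fe.
by move=> x y; rewrite cmulDl.
Qed.

Lemma gap_star : star (beta F v) = beta F v.
Proof.
rewrite starB p_star; congr (_ - _).
rewrite (fsum_morph _ fin (star0 CE) (@starD R CE)).
by apply: eq_fsbigr => e _; rewrite starM starK.
Qed.

Lemma gap_s0 e : src e = v -> edges F e -> beta F v ** s e = 0.
Proof. by move=> ev Fe; rewrite cmulBl out_proj_s// -ev ps subrr. Qed.

Lemma gap_s_src e : src e <> v -> beta F v ** s e = 0.
Proof. by move=> ev; rewrite cmulBl out_proj_s0 ?subr0 ?ps0// => [/esym//|[]]. Qed.

Lemma p_gap : p v ** beta F v = beta F v.
Proof.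
rewrite cmulBr p_idem (fsum_morph _ fin (cmulx0 _) (cmulDr _)); congr (_ - _).
by apply: eq_fsbigr => e /set_mem[Fe <-]; rewrite cmulA ps.
Qed.

Lemma gap_p : beta F v ** p v = beta F v.
Proof. by apply: star_inj; rewrite starM gap_star p_star p_gap. Qed.

End Gap.

Lemma p_gap0 F v w : reg F v -> w <> v -> p w ** beta F v = 0.
Proof. by move=> rv wv; rewrite -(p_gap rv) cmulA p_orth// cmul0x. Qed.

Lemma gap_p0 F v w : reg F v -> v <> w -> beta F v ** p w = 0.
Proof. by move=> rv wv; rewrite -(gap_p rv) -cmulA p_orth// cmulx0. Qed.

Lemma gap_gap0 F G v w : reg F v -> reg G w -> v <> w -> beta F v ** beta G w = 0.
Proof. by move=> rv rw vw; rewrite -(gap_p rv) -cmulA p_gap0// cmulx0. Qed.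

(** Edges outside [F] are omitted because s_e = s_e p_{r(e)}, where r(e) is outside [F] in the cases
    considered. Gaps at vertices regular in [E] are omitted because they are sums of s_e s_e^* over
    edges outside [F]. *)
Inductive kernel_gen F : CE -> Prop :=
| kernel_gen_p v : ~ verts F v -> kernel_gen F (p v)
| kernel_gen_gap v : reg F v -> ~ reg (whole E) v -> kernel_gen F (beta F v).

Lemma kernel_gen_star F a : kernel_gen F a -> star a = a.
Proof. by case=> v *; rewrite ?p_star ?gap_star. Qed.

Lemma relation_ideal_gen F (S : set CE) : closed_star_ideal S ->
  (forall e, ~ edges F e -> ~ verts F (rng e)) ->
  (forall a, kernel_gen F a -> S a) -> relation_ideal F S.
Proof.
move=> hS Frng Sgen.
have Ss e : ~ edges F e -> S (s e).
  move=> /Frng nr; rewrite -sp; apply: (csiMl hS); apply: Sgen; exact: kernel_gen_p.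
split=> //.
- by move=> v _ nv; apply: Sgen; exact: kernel_gen_p.
- by move=> e _; exact: Ss.
- move=> v rv; have [rw|nrw] := pselect (reg (whole E) v); last first.
    by apply: Sgen; exact: kernel_gen_gap.
  have [_ _ fin] := rw; rewrite /gap -/(p v) (CK_sum CK rw) /out_proj fsumB_subset//; last by move=> e [].
  apply: fsum_ind; [exact: finite_setD | exact: csi0 hS | exact: (csiD hS) |].
  move=> e [[_ ev] nFe]; apply: (csiMr hS); apply: Ss => Fe; exact: nFe.
Qed.

(* The closed span of the elements s_mu t, with mu a path and t in the range of
   a generator of the kernel for F, is the left ideal those generators span. *)
Inductive spine F : CE -> Prop :=
| spine_gen b t : kernel_gen F b -> spine F (b ** t)
| spine_s e x : spine F x -> spine F (s e ** x).

Record closed_subspace (W : set CE) : Prop := {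
  sub0 : W 0;
  subD : forall x y, W x -> W y -> W (x + y);
  subZ : forall (a : R[i]) x, W x -> W (a *: x);
  sub_closed : closed W
}.

Definition spine_span F : set CE :=
  [set x | forall W, closed_subspace W -> spine F `<=` W -> W x].

Section TwoSides.
Variables (F1 F2 : subgraph E) (ad : admissible F1 F2).

Lemma p_spine v x : spine F2 x -> p v ** x = 0 \/ spine F2 (p v ** x).
Proof.
case=> [b t [u nu|u ru nru]|e y y_spine].
- have [vu|vu] := pselect (v = u); last by left; rewrite cmulA p_orth// cmul0x.
  by subst u; right; rewrite cmulA p_idem; apply: spine_gen; exact: kernel_gen_p.
- have [vu|vu] := pselect (v = u); last by left; rewrite cmulA p_gap0// cmul0x.
  by subst u; right; rewrite cmulA p_gap//; apply: spine_gen; exact: kernel_gen_gap.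
- have [->|ve] := pselect (v = src e); last by left; rewrite cmulA ps0// cmul0x.
  by right; rewrite cmulA ps; exact: spine_s.
Qed.

(** On a nonempty path s_e^* removes the first edge or gives 0. On a generator it gives 0 unless [e]
    leaves the vertex of the generator and lies outside [F2]; then s_e^* = p_{r(e)} s_e^* itself
    starts with a vertex generator. *)
Lemma star_s_spine e x : spine F2 x -> star (s e) ** x = 0 \/ spine F2 (star (s e) ** x).
Proof.
have pr : p (rng e) ** star (s e) = star (s e) by exact: (CK_p_star_s CK).
have base y : ~ edges F2 e -> spine F2 (star (s e) ** y).
  move=> ne; rewrite -pr -cmulA; apply: spine_gen; apply: kernel_gen_p.
  exact: rng_notin_F1 (admissible_sym ad) _ ne.
case=> [b t [u nu|u ru nru]|f y y_spine].
- have [eu|eu] := pselect (src e = u); last first.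
    left; have : p u ** s e = 0 by rewrite ps0//; exact: nesym.
    by move=> /(congr1 (@star R CE)); rewrite starM p_star star0 cmulA => ->; rewrite cmul0x.
  by right; apply: base => /edges_src; rewrite eu.
- have [eu|eu] := pselect (src e = u); last first.
    left; have := gap_s_src ru eu.
    move=> /(congr1 (@star R CE)); rewrite starM gap_star// star0 cmulA => ->.
    by rewrite cmul0x.
  have [e2|e2] := pselect (edges F2 e); last by right; exact: base.
  left; have := gap_s0 ru eu e2.
  move=> /(congr1 (@star R CE)); rewrite starM gap_star// star0 cmulA => ->.
  by rewrite cmul0x.
- have [->|ef] := pselect (e = f); last by left; rewrite cmulA (CK_star_ss0 CK)// cmul0x.
  by rewrite cmulA (CK_source CK)//; exact: p_spine.
Qed.

Lemma spine_span_invariant y x : spine_span F2 x -> spine_span F2 (y ** x).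
Proof.
(* Both [y] and [star y] are required to preserve the span, which makes [T] stable under the
   adjoint; [T] then contains the generators and hence everything. *)
pose T : set CE := [set y | (forall x, spine_span F2 x -> spine_span F2 (y ** x)) /\
  (forall x, spine_span F2 x -> spine_span F2 (star y ** x))].
suff yT : T y by exact: yT.1.
have gen z : (forall x, spine F2 x -> z ** x = 0 \/ spine F2 (z ** x)) ->
    forall x, spine_span F2 x -> spine_span F2 (z ** x).
  move=> hz {}x xW W hW sW; apply: (xW [set x | W (z ** x)]).
    split=> /=.
    - by rewrite cmulx0; exact: sub0 hW.
    - by move=> u v Wu Wv; rewrite cmulDr; exact: (subD hW).
    - by move=> a u Wu; rewrite cmulZr; exact: (subZ hW).
    - by apply: closed_comp (sub_closed hW) => u _; exact: continuous_cmull.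
  move=> u /hz[zu|zu]; last exact: sW.
  by rewrite /= zu; exact: sub0 hW.
have cssT : closed_star_subalgebra T.
  split.
  - by split=> {}x _ W hW _; rewrite ?star0 cmul0x; exact: sub0 hW.
  - move=> u v [u1 u2] [v1 v2]; split=> {}x xW W hW sW; rewrite ?starD cmulDl; apply: (subD hW).
    + exact: u1. + exact: v1. + exact: u2. + exact: v2.
  - move=> a u [u1 u2]; split=> {}x xW W hW sW; rewrite ?starZ cmulZl; apply: (subZ hW).
      exact: u1.
    exact: u2.
  - move=> u v [u1 u2] [v1 v2]; split=> {}x xW; first by rewrite -cmulA; apply: u1; exact: v1.
    by rewrite starM -cmulA; apply: v2; exact: u2.
  - by move=> u [u1 u2]; split=> //; rewrite starK.
  - move=> u clu; split=> {}x xW W hW sW.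
      have cl : closed [set y : CE | W (y ** x)].
        by apply: closed_comp (sub_closed hW) => z _; exact: continuous_cmulr.
      by apply: cl; apply: closure_subset clu => z [z1 _] /=; exact: z1.
    have cl : closed [set y : CE | W (star y ** x)].
      apply: closed_comp (sub_closed hW) => z _.
      apply: (@continuous_comp _ _ _ (@star R CE) (fun w => w ** x)).
        exact: continuous_star.
      exact: continuous_cmulr.
    by apply: cl; apply: closure_subset clu => z [_ z2] /=; exact: z2.
rewrite (gc_generated cssT)//.
- move=> v _; have hv := @p_spine v.
  by split; apply: gen => // z; rewrite -/(p v) p_star; exact: hv.
- move=> e _; split; apply: gen => z zs; last exact: star_s_spine.
  by right; exact: spine_s.
Qed.

(** Induction on the path, for all [a] at once. An edge in [F1] is killed by [a]. After an edge
    outside [F1] the product is s_e p_{r(e)} x, and p_{r(e)} is again a generator for [F1], so the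
    induction hypothesis applies with it in place of [a]. *)
Lemma kernel_gen_spine a x : kernel_gen F1 a -> spine F2 x -> a ** x = 0.
Proof.
move=> ka xs; elim: xs a ka => {x} [b t kb|e x _ IH] a ka.
  suff ab0 : a ** b = 0 by rewrite cmulA ab0 cmul0x.
  (* In each case the two generators sit at different vertices: the subgraphs cover [E]; a gap of
     one side sits at a vertex of the other; and a vertex regular on both sides is regular in [E],
     where no gap generator sits. *)
  case: ka kb => [v nv|v rv nrv] [u nu|u ru nru].
  - by apply: p_orth => vu; case: (ad_v ad v) => //; rewrite vu.
  - apply: p_gap0 => // vu; apply: nv; rewrite vu.
    exact: breaking_vertex (admissible_sym ad) _ ru nru.
  - apply: gap_p0 => // vu; apply: nu; rewrite -vu.
    exact: breaking_vertex ad _ rv nrv.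
  - apply: gap_gap0 => // vu; apply: nrv; apply: (reg_both ad) => //.
    by rewrite vu.
have sx : ~ edges F1 e -> s e ** x = 0.
  move=> /(rng_notin_F1 ad) nr; rewrite -sp -cmulA IH ?cmulx0//.
  exact: kernel_gen_p.
case: ka => [v nv|v rv nrv].
  have [ve|ve] := pselect (v = src e); last by rewrite cmulA ps0// cmul0x.
  by rewrite sx ?cmulx0// => /edges_src; rewrite -ve.
have [ev|ev] := pselect (src e = v); last by rewrite cmulA gap_s_src// cmul0x.
have [e1|e1] := pselect (edges F1 e); first by rewrite cmulA gap_s0// cmul0x.
by rewrite sx ?cmulx0.
Qed.

Lemma kernel_gen_orthogonal a b y : kernel_gen F1 a -> kernel_gen F2 b -> a ** (y ** b) = 0.
Proof.
move=> ka kb.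
have bspan : spine_span F2 b.
  move=> W _; apply; case: kb => [v nv|v rv nrv].
    by rewrite -p_idem; apply: spine_gen; exact: kernel_gen_p.
  by rewrite -(gap_p rv); apply: spine_gen; exact: kernel_gen_gap.
(* The right annihilator of [a] is a closed subspace containing the spine, hence its closed span, to
   which [y ** b] belongs. *)
suff : [set x | a ** x = 0] (y ** b) by [].
apply: (spine_span_invariant y bspan); last by move=> x; exact: kernel_gen_spine.
split=> /=.
- by rewrite cmulx0.
- by move=> u v au av; rewrite cmulDr au av addr0.
- by move=> c u au; rewrite cmulZr au scaler0.
- by apply: closed_equalizer; [exact: continuous_cmull | move=> ?; exact: cvg_cst].
Qed.

End TwoSides.

End Orthogonality.

(** * Existence of the gauge action *)

Section GaugeAction.
Variables (R : realType) (E : digraph) (F : subgraph E) (A : graph_cstar R F).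

Let CK := gc_family A.

Lemma unit_circleM (z w : R[i]) : unit_circle z -> unit_circle w -> unit_circle (z * w).
Proof. by rewrite /unit_circle /= normrM => -> ->; rewrite mulr1. Qed.

Lemma CK_family_rotate (z : R[i]) : unit_circle z ->
  CK_family F (gc_p A) (fun e => z *: gc_s A e).
Proof.
move=> z1; have zz : z * z^* = 1 by rewrite -normCK (z1 : `|z| = 1) expr1n.
have ts e : (z *: gc_s A e) ** star (z *: gc_s A e) = gc_s A e ** star (gc_s A e).
  by rewrite starZ cmulZl cmulZr scalerA zz scale1r.
have st e : star (z *: gc_s A e) ** (z *: gc_s A e) = star (gc_s A e) ** gc_s A e.
  by rewrite starZ cmulZl cmulZr scalerA mulrC zz scale1r.
split.
- exact: CK_proj CK.
- exact: CK_proj_orth CK.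
- by move=> e Fe; rewrite /partial_isometry ts cmulZr (CK_isom CK Fe).
- by move=> e f Fe Ff ef; rewrite !ts (CK_range_orth CK Fe Ff ef).
- by move=> e Fe; rewrite st (CK_source CK Fe).
- by move=> e Fe; rewrite ts; exact: CK_range CK _ Fe.
- by move=> v rv; rewrite (CK_sum CK rv); apply: eq_fsbigr => e _; rewrite ts.
Qed.

Lemma gauge_action_exists : exists g, @gauge_action R E F A g.
Proof.
have /choice[g hg] (z : R[i]) : exists f : A -> A, star_hom f /\ (unit_circle z ->
    (forall v, verts F v -> f (gc_p A v) = gc_p A v) /\
    (forall e, edges F e -> f (gc_s A e) = z *: gc_s A e)).
  (* Off the circle the identity is chosen, so that every [g z] is a star-homomorphism, hence
     contractive. *)
  have [z1|z1] := pselect (unit_circle z); last first.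
    by exists (fun x => x); split=> //; exact: star_hom_id.
  by have [f [hf fp fs]] := gc_universal A (CK_family_rotate z1); exists f.
have hom z : star_hom (g z) := (hg z).1.
have gp z v : unit_circle z -> verts F v -> g z (gc_p A v) = gc_p A v.
  by move=> z1; exact: ((hg z).2 z1).1.
have gs z e : unit_circle z -> edges F e -> g z (gc_s A e) = z *: gc_s A e.
  by move=> z1; exact: ((hg z).2 z1).2.
have u1 : unit_circle (1 : R[i]) by rewrite /unit_circle /= normr1.
exists g; split=> //; split.
- by move=> z _.
- apply: (gc_hom_ext (hom 1) (star_hom_id A)) => [v Fv|e Fe]; first exact: gp.
  by rewrite gs// scale1r.
- move=> z w x z1 w1; apply: (gc_hom_ext (hom _) (star_hom_comp (hom w) (hom z))) => [v Fv|e Fe].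
    by rewrite !gp//; exact: unit_circleM.
  rewrite !gs//; last exact: unit_circleM.
  by rewrite star_homZ// gs// scalerA mulrC.
(* The elements with continuous orbit form a closed star-subalgebra; closedness is a three-epsilon
   argument using that all [g z] are contractive. *)
pose T : set A := [set x | forall z0, unit_circle z0 ->
  (fun z : R[i]^o => g z x) @ within (@unit_circle R) (nbhs (z0 : R[i]^o)) --> g z0 x].
suff TT : T = setT.
  move=> x; apply/subspace_continuousP => z0 z01.
  have Tx : T x by rewrite TT.
  exact: Tx z0 z01.
have cssT : closed_star_subalgebra T.
  split.
  - move=> z0 _; rewrite (star_hom0 (hom z0)).
    under eq_fun => z do rewrite (star_hom0 (hom z)).
    exact: cvg_cst.
  - move=> x y Tx Ty z0 z01; rewrite star_homD//.
    under eq_fun => z do rewrite (star_homD (hom z)).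
    by apply: cvgD; [exact: Tx | exact: Ty].
  - move=> a x Tx z0 z01; rewrite star_homZ//.
    under eq_fun => z do rewrite (star_homZ (hom z)).
    by apply: cvgZr; exact: Tx.
  - move=> x y Tx Ty z0 z01; rewrite (star_homM (hom z0)).
    under eq_fun => z do rewrite (star_homM (hom z)).
    by apply: cvg_cmul; [exact: Tx | exact: Ty].
  - move=> x Tx z0 z01; rewrite (star_hom_star (hom z0)).
    under eq_fun => z do rewrite (star_hom_star (hom z)).
    exact: continuous_cvg (@continuous_star R A (g z0 x)) (Tx z0 z01).
  - apply/closed_rnormP => x cl z0 z01; apply/cvg_rnormP => e e0.
    have e3 : 0 < e / 3 by rewrite divr_gt0.
    have [y Ty xy] := cl _ e3.
    have h := (cvg_rnormP _ _).2 (Ty z0 z01) _ e3.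
    have close z : rnorm (g z x - g z y) < e / 3.
      by rewrite -star_homB//; apply: le_lt_trans xy; exact: star_hom_rnorm.
    near=> z; apply: le_lt_trans (rnorm_triangle (g z0 y) _ _) _.
    have h1 := close z0; have h2 := close z.
    have h3 : rnorm (g z0 y - g z y) < e / 3 by near: z; exact: h.
    have h4 := rnorm_triangle (g z y) (g z0 y) (g z x).
    rewrite (rnormBC (g z y)) in h4; lra.
rewrite (gc_generated cssT)// => [v Fv|e Fe] z0 z01.
  rewrite gp//; apply/cvg_rnormP => d d0.
  apply: filterS (withinT _ _) => z z1.
  by rewrite gp// subrr rnorm0.
rewrite gs//; apply/cvg_rnormP => d d0.
have cz : (fun z : R[i]^o => z *: gc_s A e) @ within (@unit_circle R) (nbhs (z0 : R[i]^o))
    --> z0 *: gc_s A e.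
  by apply: cvgZl; apply: cvg_within.
have h := (cvg_rnormP _ _).2 cz _ d0.
near=> z; rewrite gs; first by near: z; exact: h.
by near: z; exact: withinT.
Unshelve. all: by end_near. Qed.

End GaugeAction.

(** * The two kernels and their sum *)

Section Kernels.
Variables (R : realType) (E : digraph) (F1 F2 : subgraph E) (ad : admissible F1 F2).
Variables (CE : graph_cstar R (whole E)) (C1 : graph_cstar R F1) (C2 : graph_cstar R F2).
Variables (rho1 : CE -> C1) (rho2 : CE -> C2).
Hypotheses (h1 : canonical_hom rho1) (h2 : canonical_hom rho2).

(** Orthogonality of generators is extended one factor at a time. [S1] and [S2] are closed
    star-ideals: the free middle factor absorbs products, and asking for the adjoint as well gives
    stability under [star]. *)
Lemma kernels_annihilate x y b : rho1 x = 0 -> rho2 b = 0 -> x ** y ** b = 0.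
Proof.
have closed0 (f : CE -> CE) : continuous f -> closed [set u | f u = 0].
  by move=> fc; apply: closed_equalizer => // ?; exact: cvg_cst.
pose S1 : set CE := [set x | forall y b, kernel_gen F2 b ->
  x ** y ** b = 0 /\ star x ** y ** b = 0].
have hS1 : closed_star_ideal S1.
  split.
  - by move=> {}y {}b _; rewrite star0 !cmul0x.
  - by move=> u v hu hv {}y {}b kb; have [u1 u2] := hu y b kb; have [v1 v2] := hv y b kb;
      rewrite starD !cmulDl u1 u2 v1 v2 addr0.
  - by move=> a u hu {}y {}b kb; have [u1 u2] := hu y b kb; rewrite starZ !cmulZl u1 u2 !scaler0.
  - move=> z u hu {}y {}b kb; have [u1 _] := hu y b kb; have [_ u2] := hu (star z ** y) b kb.
    by rewrite starM -!cmulA (cmulA u) u1 cmulx0 (cmulA (star z)) cmulA u2.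
  - by move=> u hu {}y {}b kb; have [u1 u2] := hu y b kb; rewrite starK.
  - move=> u clu {}y {}b kb.
    have cl1 : closed [set u : CE | u ** (y ** b) = 0] by apply: closed0; exact: continuous_cmulr.
    have cl2 : closed [set u : CE | star u ** (y ** b) = 0].
      apply: closed0 => w; apply: (@continuous_comp _ _ _ (@star R CE) (fun w => w ** (y ** b))).
        exact: continuous_star.
      exact: continuous_cmulr.
    rewrite -!cmulA; split.
      by apply: cl1; apply: closure_subset clu => z /(_ y b kb)[z1 _] /=; rewrite cmulA.
    by apply: cl2; apply: closure_subset clu => z /(_ y b kb)[_ z2] /=; rewrite cmulA.
have ker1 : forall x, rho1 x = 0 -> S1 x.
  apply: canonical_hom_kernel h1 _ => //; apply: relation_ideal_gen => //.
    exact: rng_notin_F1 ad.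
  move=> a ka {}y {}b kb; rewrite (kernel_gen_star ka) -cmulA.
  by rewrite (kernel_gen_orthogonal ad).
pose S2 : set CE := [set b | forall x y, rho1 x = 0 -> x ** y ** b = 0 /\ x ** y ** star b = 0].
have hS2 : closed_star_ideal S2.
  split.
  - by move=> {}x {}y _; rewrite star0 !cmulx0.
  - by move=> u v hu hv {}x {}y kx; have [u1 u2] := hu x y kx; have [v1 v2] := hv x y kx;
      rewrite starD !cmulDr u1 u2 v1 v2 addr0.
  - by move=> a u hu {}x {}y kx; have [u1 u2] := hu x y kx; rewrite starZ !cmulZr u1 u2 !scaler0.
  - move=> z u hu {}x {}y kx; have [_ u2] := hu x y kx; have [u1 _] := hu x (y ** z) kx.
    by rewrite starM !cmulA u2 cmul0x -(cmulA x) u1.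
  - by move=> u hu {}x {}y kx; have [u1 u2] := hu x y kx; rewrite starK.
  - move=> u clu {}x {}y kx.
    have cl1 : closed [set u : CE | x ** y ** u = 0] by apply: closed0; exact: continuous_cmull.
    have cl2 : closed [set u : CE | x ** y ** star u = 0].
      apply: closed0 => w; apply: (@continuous_comp _ _ _ (@star R CE) (fun w => x ** y ** w)).
        exact: continuous_star.
      exact: continuous_cmull.
    split.
      by apply: cl1; apply: closure_subset clu => z /(_ x y kx)[z1 _].
    by apply: cl2; apply: closure_subset clu => z /(_ x y kx)[_ z2].
have ker2 : forall b, rho2 b = 0 -> S2 b.
  apply: canonical_hom_kernel h2 _ => //; apply: relation_ideal_gen => //.
    exact: rng_notin_F1 (admissible_sym ad).
  by move=> c kc {}x {}y kx; rewrite (kernel_gen_star kc); have [] := ker1 x kx y c kc.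
by move=> kx kb; have [] := ker2 b kb x y kx.
Qed.

(** Here x x^* x = 0, so the self-adjoint x^* x has square 0, and the C*-identity applies twice. *)
Lemma kernels_disjoint x : rho1 x = 0 -> rho2 x = 0 -> x = 0.
Proof.
move=> k1 k2; apply: cstar_eq0; apply: cstar_eq0.
by rewrite starM starK cmulA -(cmulA (star x)) -(cmulA (star x)) (kernels_annihilate _ k1 k2) cmulx0.
Qed.

(** The middle factor above cannot be set to 1. Instead w = a^* b satisfies w w^* = a^* b (b^* a),
    with a^* in the first kernel and b^* a in the second. *)
Lemma kernels_star_orthogonal a b : rho1 a = 0 -> rho2 b = 0 -> star a ** b = 0.
Proof.
move=> ka kb; apply: star_inj; rewrite star0; apply: cstar_eq0; rewrite starK.
rewrite starM starK; apply: kernels_annihilate.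
  by rewrite (star_hom_star (ch_hom h1)) ka star0.
by rewrite (star_homM (ch_hom h2)) (star_hom_star (ch_hom h2)) kb star0 cmul0x.
Qed.

Definition kernel_sum : set CE := [set a + b | a in [set a | rho1 a = 0] & b in [set b | rho2 b = 0]].

Lemma kernel_sum_ideal : closed_star_ideal kernel_sum.
Proof.
have I1 := csi_kernel (ch_hom h1); have I2 := csi_kernel (ch_hom h2).
split.
- by exists 0; [exact: csi0 I1 | exists 0; [exact: csi0 I2 | rewrite addr0]].
- move=> _ _ [a ka [b kb <-]] [a' ka' [b' kb' <-]].
  by exists (a + a'); [exact: (csiD I1) | exists (b + b'); [exact: (csiD I2) | rewrite addrACA]].
- move=> c _ [a ka [b kb <-]].
  by exists (c *: a); [exact: (csiZ I1) | exists (c *: b); [exact: (csiZ I2) | rewrite scalerDr]].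
- move=> z _ [a ka [b kb <-]].
  by exists (z ** a); [exact: (csiMl I1) | exists (z ** b); [exact: (csiMl I2) | rewrite cmulDr]].
- move=> _ [a ka [b kb <-]].
  by exists (star a); [exact: (csi_star I1) | exists (star b); [exact: (csi_star I2) | rewrite starD]].
apply/closed_rnormP => x cl.
have d0 n : 0 < 2^-1 ^+ n :> R by rewrite exprn_gt0// invr_gt0.
have /choice[u hu] n : exists u : CE * CE, [/\ rho1 u.1 = 0, rho2 u.2 = 0 &
    rnorm (x - (u.1 + u.2)) < 2^-1 ^+ n].
  by have [_ [a ka [b kb <-]] h] := cl _ (d0 n); exists (a, b).
(* The summands are orthogonal, so the norm of the first is at most that of the sum. *)
have le a b : rho1 a = 0 -> rho2 b = 0 -> rnorm a <= rnorm (a + b).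
  move=> ka kb; have [->|a0] := eqVneq (rnorm a) 0; first exact: rnorm_ge0.
  have ap : 0 < rnorm a by rewrite lt_neqAle eq_sym a0 rnorm_ge0.
  rewrite -(ler_pM2l ap) -expr2 -rnorm_cstar.
  have -> : star a ** a = star a ** (a + b).
    by rewrite cmulDr (kernels_star_orthogonal ka kb) addr0.
  by apply: le_trans (rnormM _ _) _; rewrite rnorm_star.
have k1 n : rho1 (u n).1 = 0 by have [] := hu n.
have k2 n : rho2 (u n).2 = 0 by have [] := hu n.
have /cvg_ex[a ua] : cvgn (fun n => (u n).1).
  (* Consecutive approximants of [x] differ by at most 2^-n + 2^-(n+1), and [le] passes this bound
     to their first summands. *)
  apply: (@geometric_cauchy_cvg _ _ _ 2 2^-1); first by apply/andP; split; lra.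
  move=> n; apply: le_trans (le _ ((u n.+1).2 - (u n).2) _ _) _.
  - by rewrite (star_homB (ch_hom h1)) !k1 subrr.
  - by rewrite (star_homB (ch_hom h2)) !k2 subrr.
  rewrite addrACA -opprD; apply: le_trans (rnorm_triangle x _ _) _.
  have [_ _ +] := hu n.+1; have [_ _] := hu n; rewrite (rnormBC x) exprS => hn hn1.
  by rewrite (rnormBC _ x); have := d0 n; lra.
have ka : rho1 a = 0.
  apply: (closed_cvg [set x | rho1 x = 0] (csi_closed I1) _ _ ua).
  by apply: nearW => n; exact: k1.
have kb : rho2 (x - a) = 0.
  have ux : (fun n => (u n).2) @ \oo --> x - a.
    have -> : (fun n => (u n).2) = (fun n => ((u n).1 + (u n).2) - (u n).1).
      by apply/funext => n; rewrite addrAC subrr add0r.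
    apply: cvgB => //; apply/cvg_rnormP => e e0.
    have : (fun n => 2^-1 ^+ n : R) @ \oo --> 0 by apply: cvg_expr; rewrite ger0_norm; lra.
    move=> /cvgrPdist_lt /(_ _ e0); apply: filterS => n.
    rewrite sub0r normrN (gtr0_norm (d0 n)); apply: lt_trans.
    by have [] := hu n.
  apply: (closed_cvg [set x | rho2 x = 0] (csi_closed I2) _ _ ux).
  by apply: nearW => n; exact: k2.
by exists a => //; exists (x - a) => //; rewrite addrC subrK.
Qed.

Lemma kernel_sum_relation : relation_ideal (subgraphI F1 F2) kernel_sum.
Proof.
have I1 := csi_kernel (ch_hom h1); have I2 := csi_kernel (ch_hom h2).
have hS := kernel_sum_ideal.
have in1 x : rho1 x = 0 -> kernel_sum x.
  by move=> kx; exists x => //; exists 0; [exact: csi0 I2 | rewrite addr0].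
have in2 x : rho2 x = 0 -> kernel_sum x.
  by move=> kx; exists 0; [exact: csi0 I1 | exists x => //; rewrite add0r].
have s12 e : ~ (edges F1 `&` edges F2) e -> kernel_sum (gc_s CE e).
  move=> ne; have [e1|e1] := pselect (edges F1 e); last by apply: in1; exact: (ch_s0 h1 I e1).
  by apply: in2; apply: (ch_s0 h2 I) => e2; apply: ne.
(* The gaps for [F] and for the intersection differ by the sum of s_e s_e^* over edges of [F] that
   are not shared. Condition (d) supplies an [F] in which [v] is regular, whose own gap then
   vanishes in C*(F). *)
have gapD (F : subgraph E) v : reg F v -> edges F1 `&` edges F2 `<=` edges F ->
    kernel_sum (gap F (gc_p CE) (gc_s CE) v) ->
    kernel_sum (gap (subgraphI F1 F2) (gc_p CE) (gc_s CE) v).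
  move=> [_ _ fin] sF gF.
  have -> : gap (subgraphI F1 F2) (gc_p CE) (gc_s CE) v = gap F (gc_p CE) (gc_s CE) v +
      (out_proj F (gc_s CE) v - out_proj (subgraphI F1 F2) (gc_s CE) v).
    by rewrite /gap addrA subrK.
  apply: (csiD hS) => //; rewrite /out_proj fsumB_subset//; last first.
    by move=> e [e12 ev]; split=> //; exact: sF.
  apply: fsum_ind; [exact: finite_setD | exact: csi0 hS | exact: (csiD hS) |].
  by move=> e [[_ ev] ne]; apply: (csiMr hS); apply: s12 => e12; exact: ne.
split=> //.
- move=> v _ nv; have [v1|v1] := pselect (verts F1 v); last by apply: in1; exact: (ch_p0 h1 I v1).
  by apply: in2; apply: (ch_p0 h2 I) => v2; exact: nv.
- by move=> e _; exact: s12.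
- move=> v rv; case: (ad_reg ad rv) => r; apply: (gapD _ _ r) => [e []//|].
    by apply: in1; exact: ri_gap (kernel_relation_ideal h1) _ r.
  by apply: in2; exact: ri_gap (kernel_relation_ideal h2) _ r.
Qed.

End Kernels.

Lemma gauge_equivariant (R : realType) (E : digraph) (F G : subgraph E)
    (A : graph_cstar R F) (B : graph_cstar R G) (f : A -> B) gA gB :
  canonical_hom f -> @gauge_action R E F A gA -> @gauge_action R E G B gB ->
  equivariant gA gB f.
Proof.
move=> hf hA hB z x z1.
have homA := action_hom (gauge_circle hA) z1; have homB := action_hom (gauge_circle hB) z1.
apply: (gc_hom_ext (star_hom_comp homA (ch_hom hf)) (star_hom_comp (ch_hom hf) homB)) => [v Fv|e Fe].
  rewrite (gauge_p hA)//; have [Gv|Gv] := pselect (verts G v).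
    by rewrite (ch_p hf)// (gauge_p hB).
  by rewrite (ch_p0 hf)// (star_hom0 homB).
rewrite (gauge_s hA)// (star_homZ (ch_hom hf)); have [Ge|Ge] := pselect (edges G e).
  by rewrite (ch_s hf)// (gauge_s hB).
by rewrite (ch_s0 hf)// (star_hom0 homB) scaler0.
Qed.

Lemma canonical_homW (R : realType) (E : digraph) (F G : subgraph E)
    (A : graph_cstar R F) (B : graph_cstar R G) (f : A -> B) :
  verts G `<=` verts F -> edges G `<=` edges F -> canonical_hom f -> canonical_surjection f.
Proof.
by move=> sv se hf; have surj := canonical_hom_surjective sv se hf; case: hf => *; split.
Qed.

Theorem theorem4p4 (R : realType) (E : digraph) (F1 F2 : subgraph E)
    (hadm : admissible_decomposition F1 F2)
    (CE : graph_cstar R (whole E)) (C1 : graph_cstar R F1)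
    (C2 : graph_cstar R F2) (C12 : graph_cstar R (subgraphI F1 F2)) :
  exists (gE : R[i] -> CE -> CE) (g1 : R[i] -> C1 -> C1)
         (g2 : R[i] -> C2 -> C2) (g12 : R[i] -> C12 -> C12),
    [/\ gauge_action gE, gauge_action g1, gauge_action g2 & gauge_action g12] /\
  exists (rho1 : CE -> C1) (rho2 : CE -> C2)
         (mu1 : C1 -> C12) (mu2 : C2 -> C12),
    [/\ canonical_surjection rho1, canonical_surjection rho2,
        canonical_surjection mu1 & canonical_surjection mu2] /\
    T_pullback gE g1 g2 g12 rho1 rho2 mu1 mu2.
Proof.
have ad := admissible_decompositionP hadm; have ad' := admissible_sym ad.
have [gE hE] := gauge_action_exists CE; have [g1 hg1] := gauge_action_exists C1.
have [g2 hg2] := gauge_action_exists C2; have [g12 hg12] := gauge_action_exists C12.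
have qsE1 := quotient_subgraph_whole ad; have qsE2 := quotient_subgraph_whole ad'.
have qs1 := quotient_subgraph_part (G := subgraphI F1 F2) ad erefl erefl.
have qs2 := quotient_subgraph_part (G := subgraphI F1 F2) ad' (setIC _ _) (setIC _ _).
have [rho1 r1] := canonical_hom_exists CE C1 qsE1.
have [rho2 r2] := canonical_hom_exists CE C2 qsE2.
have [mu1 m1] := canonical_hom_exists C1 C12 qs1.
have [mu2 m2] := canonical_hom_exists C2 C12 qs2.
have surj1 := canonical_hom_surjective (qs_verts qsE1) (qs_edges qsE1) r1.
have surj2 := canonical_hom_surjective (qs_verts qsE2) (qs_edges qsE2) r2.
have m1r1 := canonical_hom_comp (qs_verts qs1) (qs_edges qs1) r1 m1.
have m2r2 := canonical_hom_comp (qs_verts qs2) (qs_edges qs2) r2 m2.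
have comm := canonical_hom_unique m1r1 m2r2.
have [e1 e2] := (gauge_equivariant r1 hE hg1, gauge_equivariant r2 hE hg2).
exists gE, g1, g2, g12; split=> //; exists rho1, rho2, mu1, mu2; split.
  by split; apply: canonical_homW => //; first [exact: qs_verts | exact: qs_edges].
have hr1 := ch_hom r1; have hr2 := ch_hom r2.
have hm1 := ch_hom m1; have hm2 := ch_hom m2.
split=> //.
- by split; exact: gauge_circle.
- by split; split=> //; [exact: gauge_equivariant m1 hg1 hg12 | exact: gauge_equivariant m2 hg2 hg12].
- split; first split.
  + by move=> a x y; rewrite /pair_map (star_hom_linear hr1) (star_hom_linear hr2).
  + by move=> x y; rewrite /pair_map (star_homM hr1) (star_homM hr2).
  + by move=> x; rewrite /pair_map (star_hom_star hr1) (star_hom_star hr2).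
  + by move=> z x z1; rewrite /pair_map /sum_action /= e1// e2.
- move=> x y [xy1 xy2]; apply/eqP; rewrite -subr_eq0; apply/eqP.
  by apply: (kernels_disjoint ad r1 r2); rewrite ?(star_homB hr1) ?(star_homB hr2) ?xy1 ?xy2 subrr.
- apply/seteqP; split=> [_ [x _ <-]|[a b] /= ab]; first exact: comm.
  have [x _ xa] : range rho1 a by rewrite surj1.
  have [y _ yb] : range rho2 b by rewrite surj2.
  have : mu1 (rho1 (x - y)) = 0.
    by rewrite (star_homB hr1) (star_homB hm1) xa ab comm yb subrr.
  have vI : verts (subgraphI F1 F2) `<=` verts (whole E) by [].
  have eI : edges (subgraphI F1 F2) `<=` edges (whole E) by [].
  move=> /(canonical_hom_kernel vI eI m1r1 (kernel_sum_relation ad r1 r2)).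
  (* With x - y = k1 + k2, the element x - k1 = y + k2 has image [a] under [rho1] and [b] under
     [rho2]. *)
  move=> [k1 k1_0 [k2 k2_0 k12]]; exists (x - k1) => //.
  have xk : x - k1 = y + k2.
    by apply/eqP; rewrite subr_eq -addrA [k2 + _]addrC k12 addrC subrK.
  rewrite /pair_map {2}xk (star_homB hr1) (star_homD hr2).
  by rewrite (k1_0 : rho1 k1 = 0) (k2_0 : rho2 k2 = 0) subr0 addr0 xa yb.
Qed.
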